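(* Let $(M,g,f)$ be a two-dimensional gradient Ricci soliton with $M$ connected and $g$ complete. Then the Gauss curvature of $g$ is bounded on $M$.
   Context: A gradient Ricci soliton on a surface $M$ is a triple $(M,g,f)$, with $g$ a smooth Riemannian metric and $f\in C^\infty(M)$, for which there is a constant $\lambda\in\mathbb{R}$ (the expansion constant) with $-2\mathrm{Ric}(g)=L_{\nabla f}g-2\lambda g$; in dimension two this says $\nabla^2 f+K_g\,g-\lambda g=0$, where $K_g$ is the Gauss curvature. *)

(* Defs.v *)
From HB Require Import structures.
From mathcomp Require Import all_boot all_order all_algebra.
From mathcomp Require Import all_classical all_reals all_analysis.

Set Implicit Arguments.
Unset Strict Implicit.
Unset Printing Implicit Defensive.

Import Order.TTheory GRing.Theory Num.Theory.
Import numFieldNormedType.Exports.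

Local Open Scope classical_set_scope.
Local Open Scope ring_scope.

Section PlaneCalculus.
Variable R : realType.
Implicit Types (U : set 'rV[R]_2) (u : 'rV[R]_2 -> R).

Definition partial (a : 'I_2) u : 'rV[R]_2 -> R :=
  fun x => 'D_(delta_mx 0 a) u x.

Fixpoint Ck_on (k : nat) U u : Prop :=
  (forall x, U x -> {for x, continuous u}) /\
  if k is k'.+1 then
    forall a : 'I_2, (forall x, U x -> derivable u x (delta_mx 0 a)) /\
                     Ck_on k' U (partial a u)
  else True.

(* Only used on open sets [U], so that the values of [u] outside [U] are
   irrelevant. *)
Definition smooth_on U u : Prop := forall k, Ck_on k U u.

End PlaneCalculus.

Section Surfaces.
Variable R : realType.

(* [chart_inv] is only meaningful on the image of [chart_dom]. *)
Record chart (M : topologicalType) := Chart {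
  chart_dom : set M;
  chart_map :> M -> 'rV[R]_2;
  chart_inv : 'rV[R]_2 -> M;
  chart_dom_open : open chart_dom;
  chart_cod_open : open (chart_map @` chart_dom);
  chart_mapK : forall p, chart_dom p -> chart_inv (chart_map p) = p;
  chart_map_continuous : {within chart_dom, continuous chart_map};
  chart_inv_continuous :
    {within chart_map @` chart_dom, continuous chart_inv} }.

Definition chart_cod (M : topologicalType) (c : chart M) : set 'rV[R]_2 :=
  c @` chart_dom c.

Definition transition (M : topologicalType) (c c' : chart M)
  : 'rV[R]_2 -> 'rV[R]_2 := fun x => c' (chart_inv c x).

Definition overlap (M : topologicalType) (c c' : chart M) : set 'rV[R]_2 :=
  c @` (chart_dom c `&` chart_dom c').

(* A smooth manifold of dimension two without boundary, given by an atlas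
   which need not be maximal. *)
Record surface := Surface {
  surface_space :> topologicalType;
  surface_hausdorff : hausdorff_space surface_space;
  surface_second_countable : @second_countable surface_space;
  atlas_index : Type;
  atlas : atlas_index -> chart surface_space;
  atlas_cover : forall p, exists i, chart_dom (atlas i) p;
  atlas_smooth : forall i j (b : 'I_2),
    smooth_on (overlap (atlas i) (atlas j))
              (fun x => transition (atlas i) (atlas j) x 0 b) }.

Definition index_at (M : surface) (p : M) : atlas_index M :=
  sval (cid (atlas_cover p)).

Definition smooth_function (M : surface) (f : M -> R) : Prop :=
  forall i : atlas_index M, smooth_on (chart_cod (atlas i)) (f \o chart_inv (atlas i)).

(* A smooth symmetric positive definite covariant 2-tensor, given by its
   component matrices in the charts.  Tangent vectors are rows, so that the
   library's Jacobian acts on them from the right. *)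
Record riemannian_metric (M : surface) := RiemannianMetric {
  metric_mx :> atlas_index M -> 'rV[R]_2 -> 'M[R]_2;
  metric_smooth : forall (i : atlas_index M) (a b : 'I_2),
    smooth_on (chart_cod (atlas i)) (fun x => metric_mx i x a b);
  metric_sym : forall i x, chart_cod (atlas i) x ->
    (metric_mx i x)^T = metric_mx i x;
  metric_pos : forall i x (v : 'rV[R]_2), chart_cod (atlas i) x ->
    v != 0 -> 0 < (v *m metric_mx i x *m v^T) 0 0;
  metric_tensor : forall i j x, overlap (atlas i) (atlas j) x ->
    let tau := transition (atlas i) (atlas j) in
    metric_mx i x = jacobian tau x *m metric_mx j (tau x) *m (jacobian tau x)^T }.

End Surfaces.

Section LocalGeometry.
Variables (R : realType) (h : 'rV[R]_2 -> 'M[R]_2).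
Implicit Types (a b c d m : 'I_2) (x : 'rV[R]_2).

(* Gamma^c_{ab} *)
Definition christoffel c a b x : R :=
  2^-1 * \sum_d invmx (h x) c d *
    (partial a (fun y => h y b d) x + partial b (fun y => h y a d) x
     - partial d (fun y => h y a b) x).

(* The component along the d-th coordinate field of R(e_a, e_b) e_c, where
   R(X, Y) = [nabla_X, nabla_Y] - nabla_[X, Y]. *)
Definition riemann d c a b x : R :=
  partial a (christoffel d b c) x - partial b (christoffel d a c) x
  + \sum_m (christoffel d a m x * christoffel m b c x
            - christoffel d b m x * christoffel m a c x).

(* Ric(Y, Z) = tr (X |-> R(X, Y) Z) *)
Definition ricci b c x : R := \sum_a riemann a c a b x.

(* <R(e_0, e_1) e_1, e_0> / (|e_0|^2 |e_1|^2 - <e_0, e_1>^2) *)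
Definition local_gauss_curvature x : R :=
  (\sum_d h x d 0 * riemann d 1 0 1 x) / \det (h x).

Definition gradient (u : 'rV[R]_2 -> R) a x : R :=
  \sum_b invmx (h x) a b * partial b u x.

Definition lie_derivative (X : 'I_2 -> 'rV[R]_2 -> R) a b x : R :=
  \sum_c (X c x * partial c (fun y => h y a b) x
          + h x c b * partial a (X c) x + h x a c * partial b (X c) x).

End LocalGeometry.

Section RiemannianSurfaces.
Variables (R : realType) (M : surface R) (g : riemannian_metric M).

(* The value is independent of the chart chosen around [p]. *)
Definition gauss_curvature (p : M) : R :=
  local_gauss_curvature (g (index_at p)) (atlas (index_at p) p).

Definition gradient_ricci_soliton (f : M -> R) : Prop :=
  smooth_function f /\
  exists lambda : R, forall i x, chart_cod (atlas i) x -> forall a b : 'I_2,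
    - 2 * ricci (g i) a b x =
    lie_derivative (g i) (gradient (g i) (f \o chart_inv (atlas i))) a b x
    - 2 * lambda * g i x a b.

(* C^1 on an open set containing [0, 1], that is, C^1 up to the endpoints. *)
Definition C1_arc (gamma : R -> M) : Prop :=
  exists J : set R, [/\ open J, `[0, 1] `<=` J &
    forall t, J t -> {for t, continuous gamma} /\
      forall i, chart_dom (atlas i) (gamma t) ->
        derivable (atlas i \o gamma) t 1 /\
        {for t, continuous (derive1 (atlas i \o gamma))}].

Definition speed (gamma : R -> M) (t : R) : R :=
  let i := index_at (gamma t) in
  let v := derive1 (atlas i \o gamma) t in
  Num.sqrt ((v *m g i (atlas i (gamma t)) *m v^T) 0 0).

Definition arc_length (gamma : R -> M) : \bar R :=
  (\int[lebesgue_measure]_(t in `[0%R, 1%R]) (speed gamma t)%:E)%E.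

(* [joined p q l]: some piecewise C^1 curve from [p] to [q] has length [l]. *)
Inductive joined : M -> M -> \bar R -> Prop :=
| joined_refl p : joined p p 0%E
| joined_cons gamma q l : C1_arc gamma -> joined (gamma 1) q l ->
    joined (gamma 0) q (arc_length gamma + l)%E.

(* Equal to [+oo] on points in different components. *)
Definition riemannian_distance (p q : M) : \bar R :=
  ereal_inf [set l | joined p q l].

Definition complete_metric : Prop :=
  forall u : nat -> M,
    (forall e : R, 0 < e -> exists N, forall m n, (N <= m)%N -> (N <= n)%N ->
      (riemannian_distance (u m) (u n) < e%:E)%E) ->
    exists p : M, riemannian_distance (u n) p @[n --> \oo] --> 0%E.

End RiemannianSurfaces.

(* Main.v *)
From HB Require Import structures.
Require Import Defs.
From mathcomp Require Import all_boot all_order all_algebra.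
From mathcomp Require Import all_classical all_reals all_analysis.
From mathcomp Require Import measurable_realfun ring lra.
Set Implicit Arguments.
Unset Strict Implicit.
Unset Printing Implicit Defensive.
Import Order.TTheory GRing.Theory Num.Theory.
Import numFieldNormedType.Exports.
Local Open Scope classical_set_scope.
Local Open Scope ring_scope.

(* On a gradient Ricci soliton surface the Hessian of f is (lambda - K) g, and
   the Codazzi identity turns this into dK = K df.  Hence K = k e^f and
   |df|^2 + 2 k e^f - 2 lambda f = C for constants k and C.  If k > 0, then
   |df|^2 >= 0 already bounds e^f, and k = 0 is trivial.  If k < 0 and f were
   unbounded above, then |df| would be at least of order e^(f/2) where f is
   large, so that u = 1 / (1 + e^(f/2)), a multiple of which is 1-Lipschitz for
   the distance, would decrease along gradient segments at a rate bounded below.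
   Ekeland's variational principle, which takes the place of the gradient flow,
   excludes this on a complete surface. *)

(** * Calculus in the plane *)

(** That the Codazzi identity closes up is special to dimension two: the endomorphism R(e_0, e_1) is
    skew for the metric and hence has a single degree of freedom, so commuting third derivatives of
    f involves the curvature tensor only through K.

    The curvature in the statement is read in a chart selected separately at each point, so chart
    independence has to be settled before anything is constant on the surface. For |df|^2 one
    derivative of the transition maps is enough. The direct computation for K would involve three,
    and is replaced by an argument from the first integrals.

    Completeness is convergence of Cauchy sequences for a distance defined by infima of lengths. It
    is therefore applied to a sequence of points, and the only curves ever constructed are short
    straight segments in coordinates. Such a segment follows the gradient only to first order; this
    costs a constant factor in the rate of descent, which is harmless because any uniform rate gives
    the contradiction. *)

Section PlaneCalculus.
Variable R : realType.
Implicit Types (U : set 'rV[R]_2) (u v : 'rV[R]_2 -> R) (x y : 'rV[R]_2).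

Lemma sum_ord2 (V : nmodType) (F : 'I_2 -> V) : \sum_(i < 2) F i = F 0 + F 1.
Proof. by rewrite big_ord_recl big_ord1; congr (_ + F _); apply: val_inj. Qed.

Lemma ord2P (P : 'I_2 -> Prop) : P 0 -> P 1 -> forall a, P a.
Proof.
move=> P0 P1 [[|[|//]] i]; [have -> : Ordinal i = 0|have -> : Ordinal i = 1];
  by [apply: val_inj|].
Qed.

Lemma row2E x : x = x 0 0 *: delta_mx 0 0 + x 0 1 *: delta_mx 0 1.
Proof. by rewrite {1}[x]row_sum_delta sum_ord2. Qed.

Lemma delta2E (t : R) (a b : 'I_2) :
  (t *: delta_mx 0 a : 'rV[R]_2) 0 b = t *+ (b == a).
Proof. by rewrite !mxE eqxx /=; case: eqP; rewrite ?mulr1 ?mulr0. Qed.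

Lemma ball2P x (r : R) y : ball x r y <-> forall a, `|x 0 a - y 0 a| < r.
Proof.
split=> [[r0 h] a|h]; first exact: h.
by split; [apply: le_lt_trans (h 0)|move=> i j; rewrite !ord1; apply: h].
Qed.

Lemma ball_row2 x (r s t : R) : `|s| < r -> `|t| < r ->
  ball x r (s *: delta_mx 0 0 + (t *: delta_mx 0 1 + x)).
Proof.
move=> sr tr; apply/ball2P; apply: ord2P; rewrite !mxE /=;
  rewrite ?mulr1 ?mulr0 ?add0r.
  by rewrite opprD addrCA subrr addr0 normrN.
by rewrite opprD addrCA subrr addr0 normrN.
Qed.

Lemma line_is_derive (V W : normedModType R) (f : V -> W) (x v : V) (t : R) :
  derivable f (t *: v + x) v ->
  is_derive t 1 (fun s : R => f (s *: v + x)) ('D_v f (t *: v + x)).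
Proof.
set g : R -> W := fun s => f (s *: v + x).
have E : (fun h : R => h^-1 *: ((g \o shift t) (h *: 1) - g t)) =
  (fun h : R => h^-1 *: ((f \o shift (t *: v + x)) (h *: v) - f (t *: v + x))).
  apply/funext => h /=; rewrite /g; congr (_ *: (f _ - _)).
  by rewrite scalerDl addrA [h%:A]mulr1.
by move=> df; split; rewrite ?/derivable ?/derive E.
Qed.

Lemma shift_is_derive (V W : normedModType R) (f : V -> W) (w x v : V) :
  derivable f (w + x) v ->
  is_derive x v (fun z => f (w + z)) ('D_v f (w + x)).
Proof.
have E : (fun h : R => h^-1 *: (((fun z => f (w + z)) \o shift x) (h *: v) - f (w + x))) =
  (fun h : R => h^-1 *: ((f \o shift (w + x)) (h *: v) - f (w + x))).
  by apply/funext => h /=; rewrite addrCA.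
by move=> df; split; rewrite ?/derivable ?/derive E.
Qed.

Lemma differentiable_approx (V W : normedModType R) (f : V -> W) (x : V)
    (L : {linear V -> W}) :
  continuous L ->
  (forall e : R, 0 < e -> \forall v \near (0 : V), `|f (v + x) - (f x + L v)| <= e * `|v|) ->
  differentiable f x /\ 'd f x = L :> (V -> W).
Proof.
move=> cL H.
have oL : f \o shift x = cst (f x) + L +o_ (0 : V) id.
  by apply/eqaddoP => _ /posnumP[e]; exact: H.
have dE := diff_unique cL oL.
by split; [apply/diff_locallyP; rewrite dE|].
Qed.

Lemma mvt_line (V : normedModType R) (f : V -> R) (x v : V) (h : R) :
  (forall t, `|t| <= `|h| -> derivable f (t *: v + x) v) ->
  exists2 c, `|c| <= `|h| & f (h *: v + x) - f x = h * 'D_v f (c *: v + x).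
Proof.
move=> df.
have D (a b : R) : a <= b -> (forall t, a <= t <= b -> `|t| <= `|h|) ->
    exists2 c, `|c| <= `|h| &
      f (b *: v + x) - f (a *: v + x) = (b - a) * 'D_v f (c *: v + x).
  move=> ab hab.
  have [||c + E] := @MVT_segment R (fun t => f (t *: v + x))
    (fun t => 'D_v f (t *: v + x)) a b ab.
  - move=> t; rewrite in_itv /= => /andP[/ltW ha /ltW hb].
    by apply/line_is_derive/df/hab; rewrite ha hb.
  - apply: derivable_within_continuous => t; rewrite in_itv /= => /hab/df dt.
    by have [] := line_is_derive dt.
  rewrite in_itv /= => /hab hc; exists c => //.
  by rewrite E mulrC.
have [h0|h0] := leP 0 h.
  have [|c hc E] := D 0 h h0.
    by move=> t /andP[t0 th]; rewrite !ger0_norm.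
  by exists c => //; move: E; rewrite scale0r add0r subr0.
have [|c hc E] := D h 0 (ltW h0).
  by move=> t /andP[t0 th]; rewrite (ltr0_norm h0) ler0_norm ?lerN2.
exists c => //; move: E; rewrite scale0r add0r sub0r mulNr.
by move=> E; rewrite -[LHS]opprB E opprK.
Qed.

Lemma open_ball_sub U x : open U -> U x -> exists2 r : R, 0 < r & ball x r `<=` U.
Proof.
move=> oU Ux; have /nbhs_ballP[r r0 hr] : nbhs x U by exact: open_nbhs_nbhs.
by exists r.
Qed.

(** Balls of row vectors are squares for the maximum norm, so a path that moves along one axis and
    then along the other stays inside, and the mean value theorem applies to each leg. *)
Lemma constant_on_ball x (r : R) u :
  (forall y, ball x r y -> forall a, derivable u y (delta_mx 0 a) /\ partial a u y = 0) ->
  forall y, ball x r y -> u y = u x.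
Proof.
move=> H y /ball2P xy.
have yx a : `|y 0 a - x 0 a| < r by rewrite distrC.
have r0 : 0 < r by apply: le_lt_trans (yx 0).
have B1 (t : R) : `|t| < r -> ball x r (t *: delta_mx 0 1 + x).
  move=> tr; rewrite -[_ + x]add0r -(scale0r (delta_mx 0 0)).
  by apply: ball_row2; rewrite ?normr0.
have [|c0 hc0 E0] := @mvt_line _ u ((y 0 1 - x 0 1) *: delta_mx 0 1 + x)
    (delta_mx 0 0) (y 0 0 - x 0 0).
  move=> t ht; apply: (H _ _ 0).1; apply: ball_row2 => //.
  exact: le_lt_trans ht _.
have [|c1 hc1 E1] := @mvt_line _ u x (delta_mx 0 1) (y 0 1 - x 0 1).
  move=> t ht; apply: (H _ _ 1).1; apply: B1.
  exact: le_lt_trans ht _.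
rewrite [in LHS](_ : y = (y 0 0 - x 0 0) *: delta_mx 0 0 +
    ((y 0 1 - x 0 1) *: delta_mx 0 1 + x)); last first.
  by rewrite addrA -{1}[y](subrK x) {1}[y - x]row2E !mxE.
apply/eqP; rewrite -subr_eq0; apply/eqP.
rewrite -(subrKA (u ((y 0 1 - x 0 1) *: delta_mx 0 1 + x))) E0 E1.
have Z0 : 'D_(delta_mx 0 0) u (c0 *: delta_mx 0 0 +
    ((y 0 1 - x 0 1) *: delta_mx 0 1 + x)) = 0.
  by apply: (H _ _ 0).2; apply: ball_row2 => //; exact: le_lt_trans hc0 _.
have Z1 : 'D_(delta_mx 0 1) u (c1 *: delta_mx 0 1 + x) = 0.
  by apply: (H _ _ 1).2; apply: B1; exact: le_lt_trans hc1 _.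
by rewrite Z0 Z1 !mulr0 addr0.
Qed.

(** The increment is split into two legs parallel to the axes. The mean value theorem on each leg
    leaves an error of at most [e / 2] times the norm of [v]. *)
Lemma differentiable_partials x u :
  (\forall y \near x, forall a, derivable u y (delta_mx 0 a)) ->
  (forall a, {for x, continuous (partial a u)}) ->
  differentiable u x /\
  forall v : 'rV[R]_2, 'd u x v = v 0 0 * partial 0 u x + v 0 1 * partial 1 u x.
Proof.
move=> dnear pc.
pose L (v : 'rV[R]_2) := v 0 0 * partial 0 u x + v 0 1 * partial 1 u x.
have linL : linear L.
  move=> k v w; rewrite /L !mxE -[RHS]/(k * _ + _).
  by rewrite mulrDr !mulrDl !mulrA addrACA.
pose mL := GRing.isLinear.Build _ _ _ _ L linL.
pose lL : {linear 'rV[R]_2 -> R} := HB.pack L mL.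
have cL : continuous lL.
  move=> v; have cc a := @coord_continuous R 1 2 0 a v.
  exact: (cvgD (cvgM (cc 0) (cvg_cst _)) (cvgM (cc 1) (cvg_cst _))).
suff H e : 0 < e -> \forall v \near (0 : 'rV[R]_2),
    `|u (v + x) - (u x + lL v)| <= e * `|v|.
  have [du dE] := @differentiable_approx _ R^o u x lL cL H.
  by split=> [|v]; [exact: du|rewrite dE].
move=> e0.
  have [r r0 hr] : exists2 r : R, 0 < r & forall y, ball x r y -> forall a,
      derivable u y (delta_mx 0 a) /\ `|partial a u y - partial a u x| < e / 2.
    have e2 : 0 < e / 2 by rewrite divr_gt0.
    have /nbhs_ballP[r1 r10 h1] := dnear.
    have /cvgrPdist_lt/(_ _ e2)/nbhs_ballP[r2 r20 h2] := pc 0.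
    have /cvgrPdist_lt/(_ _ e2)/nbhs_ballP[r3 r30 h3] := pc 1.
    exists (Num.min r1 (Num.min r2 r3)); first by rewrite !lt_min r10 r20.
    move=> y /ball2P xy a; split.
      by apply: h1; apply/ball2P => b; have := xy b; rewrite !lt_min => /and3P[].
    rewrite distrC; elim/ord2P : a.
      by apply: h2; apply/ball2P => b; have := xy b; rewrite !lt_min => /and3P[].
    by apply: h3; apply/ball2P => b; have := xy b; rewrite !lt_min => /and3P[].
  apply/nbhs_ballP; exists r => // v /ball2P hv.
  have vn a : `|v 0 a| <= `|v|.
    by rewrite [leRHS]/Num.Def.normr /= mx_normrE (le_bigmax _ (fun ij => `|v ij.1 ij.2|) (0, a)).
  have vr a : `|v 0 a| < r by have := hv a; rewrite mxE sub0r normrN.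
  have [|c0 hc0 E0] := @mvt_line _ u (v 0 1 *: delta_mx 0 1 + x)
      (delta_mx 0 0) (v 0 0).
    move=> t ht; apply: (hr _ _ 0).1; apply: ball_row2 => //.
    by rewrite (le_lt_trans ht).
  have [|c1 hc1 E1] := @mvt_line _ u x (delta_mx 0 1) (v 0 1).
    move=> t ht; apply: (hr _ _ 1).1.
    rewrite -[_ + x]add0r -(scale0r (delta_mx 0 0)); apply: ball_row2.
      by rewrite normr0.
    by rewrite (le_lt_trans ht).
  rewrite [lL v]/(L v) /L.
  have -> : u (v + x) - (u x + (v 0 0 * partial 0 u x + v 0 1 * partial 1 u x)) =
    v 0 0 * (partial 0 u (c0 *: delta_mx 0 0 + (v 0 1 *: delta_mx 0 1 + x)) - partial 0 u x)
    + v 0 1 * (partial 1 u (c1 *: delta_mx 0 1 + x) - partial 1 u x).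
    rewrite !mulrBr -E1 -E0 [in u (v + x)](row2E v) -addrA; ring.
  apply: (le_trans (ler_normD _ _)); rewrite !normrM.
  have -> : e * `|v| = `|v| * (e / 2) + `|v| * (e / 2) by field.
  apply: lerD; apply: ler_pM => //.
    apply/ltW; apply: (hr _ _ 0).2; apply: ball_row2 => //.
    exact: le_lt_trans hc0 _.
  apply/ltW; apply: (hr _ _ 1).2.
  rewrite -[_ + x]add0r -(scale0r (delta_mx 0 0)); apply: ball_row2.
    by rewrite normr0.
  exact: le_lt_trans hc1 _.
Qed.

(** The second difference over a square of side [t] is the increment along [a] of the first
    difference along [b]; the mean value theorem is applied once in each direction. *)
Lemma mixed_difference x (r t : R) (a b : 'I_2) u : 0 < t -> t < r -> a != b ->
  (forall y, ball x r y -> derivable u y (delta_mx 0 a)) ->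
  (forall y, ball x r y -> derivable (partial a u) y (delta_mx 0 b)) ->
  exists2 y, ball x r y &
   u (t *: delta_mx 0 a + (t *: delta_mx 0 b + x)) - u (t *: delta_mx 0 a + x)
     - u (t *: delta_mx 0 b + x) + u x = t * t * partial b (partial a u) y.
Proof.
move=> t0 tr ab du dau.
have B (s s' : R) : `|s| < r -> `|s'| < r ->
    ball x r (s *: delta_mx 0 a + (s' *: delta_mx 0 b + x)).
  move=> sr s'r; apply/ball2P => c.
  have -> : (s *: delta_mx 0 a + (s' *: delta_mx 0 b + x) : 'rV[R]_2) 0 c =
     (s *: delta_mx 0 a : 'rV[R]_2) 0 c + ((s' *: delta_mx 0 b : 'rV[R]_2) 0 c + x 0 c).
    by rewrite !mxE.
  rewrite !delta2E -[x 0 c - _]opprB normrN.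
  case: eqP => [ca|_]; case: eqP => [cb|_].
  - by move: ab; rewrite -ca -cb eqxx.
  - by rewrite mulr0n add0r mulr1n addrK.
  - by rewrite mulr0n add0r mulr1n addrK.
  - by rewrite !mulr0n !add0r subrr normr0 (lt_trans t0).
have nt : `|t| = t by rewrite gtr0_norm.
have dphi (s : R) : `|s| <= `|t| ->
    is_derive (s *: delta_mx 0 a + x) (delta_mx 0 a)
      (fun z => u (t *: delta_mx 0 b + z) - u z)
      (partial a u (s *: delta_mx 0 a + (t *: delta_mx 0 b + x))
       - partial a u (s *: delta_mx 0 a + x)).
  rewrite nt => st.
  have sr : `|s| < r by apply: le_lt_trans tr.
  have d1 : derivable u (s *: delta_mx 0 a + x) (delta_mx 0 a).
    apply: du; rewrite -[x in _ + x]add0r -(scale0r (delta_mx 0 b)).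
    by apply: B => //; rewrite normr0 (lt_trans t0).
  have d2 : derivable u (s *: delta_mx 0 a + (t *: delta_mx 0 b + x)) (delta_mx 0 a).
    by apply: du; apply: B; rewrite // nt.
  have d2' : is_derive (s *: delta_mx 0 a + x) (delta_mx 0 a)
      (fun z => u (t *: delta_mx 0 b + z))
      (partial a u (s *: delta_mx 0 a + (t *: delta_mx 0 b + x))).
    by rewrite addrCA in d2 *; exact: shift_is_derive.
  have /derivableP d1' := d1.
  exact: is_deriveB.
have [|c ht E] := @mvt_line _ (fun z => u (t *: delta_mx 0 b + z) - u z) x (delta_mx 0 a) t.
  by move=> s /dphi[].
move: E; rewrite (@derive_val _ _ _ _ _ _ _ (dphi _ ht)) => E.
have [|d hd E'] := @mvt_line _ (partial a u) (c *: delta_mx 0 a + x) (delta_mx 0 b) t.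
  move=> s st; apply: dau; rewrite addrCA; apply: B.
    by rewrite (le_lt_trans ht) ?nt.
  by rewrite (le_lt_trans st) ?nt.
exists (d *: delta_mx 0 b + (c *: delta_mx 0 a + x)).
  by rewrite addrCA; apply: B; [rewrite (le_lt_trans ht) ?nt|rewrite (le_lt_trans hd) ?nt].
move: E'; rewrite addrCA => E'; rewrite E' in E.
rewrite -mulrA -E (addrCA (t *: delta_mx 0 b)); ring.
Qed.

End PlaneCalculus.

(** * Algebra of smooth functions, chain rule, symmetry of second derivatives *)

Section SmoothFunctions.
Variable R : realType.
Implicit Types (U : set 'rV[R]_2) (u v : 'rV[R]_2 -> R) (x y : 'rV[R]_2).

Lemma near_open U x (P : 'rV[R]_2 -> Prop) : open U -> U x ->
  (forall y, U y -> P y) -> \forall y \near x, P y.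
Proof. by move=> oU Ux H; apply: filterS (open_nbhs_nbhs (conj oU Ux)). Qed.

Lemma partial_ext U u v x a : open U -> U x -> (forall y, U y -> u y = v y) ->
  partial a u x = partial a v x.
Proof.
by move=> oU Ux uv; apply: near_eq_derive; apply: near_open oU Ux _.
Qed.

Lemma derivable_ext U u v x (w : 'rV[R]_2) : open U -> U x ->
  (forall y, U y -> u y = v y) -> derivable u x w -> derivable v x w.
Proof.
by move=> oU Ux uv; apply: near_eq_derivable; apply: near_open oU Ux _.
Qed.

Lemma Ck_onW k U u : Ck_on k.+1 U u -> Ck_on k U u.
Proof.
elim: k u => [|k IH] u [cu H]; split=> // a.
by split; [exact: (H a).1|exact: IH (H a).2].
Qed.

Lemma Ck_on_continuous k U u x : Ck_on k U u -> U x -> {for x, continuous u}.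
Proof. by case: k => [|k] [+ _]; exact. Qed.

Lemma Ck_onS k U u : (forall x, U x -> {for x, continuous u}) ->
  (forall a, (forall x, U x -> derivable u x (delta_mx 0 a)) /\
             Ck_on k U (partial a u)) -> Ck_on k.+1 U u.
Proof. by []. Qed.

Lemma Ck_on_ext k U u v : open U -> (forall y, U y -> u y = v y) ->
  Ck_on k U u -> Ck_on k U v.
Proof.
move=> oU; elim: k u v => [|k IH] u v uv Cu.
  split=> // x Ux; rewrite /prop_for /continuous_at -(uv _ Ux).
  exact: cvg_trans (near_eq_cvg (near_open oU Ux uv)) (Ck_on_continuous Cu Ux).
have [_ Hu] := Cu; apply: Ck_onS => [x Ux|a].
  exact: Ck_on_continuous (IH _ _ uv (Ck_onW Cu)) Ux.
split=> [x Ux|]; first exact: derivable_ext oU Ux uv ((Hu a).1 x Ux).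
by apply: IH (Hu a).2 => y Uy; exact: partial_ext oU Uy uv.
Qed.

Lemma Ck_on_cst k U (c : R) : Ck_on k U (fun=> c).
Proof.
elim: k c => [|k IH] c; first by split=> [x _|//]; exact: (@cst_continuous _ _ c x).
apply: Ck_onS => [x _|a]; first exact: (@cst_continuous _ _ c x).
split=> [x _|]; first exact: derivable_cst.
by rewrite [partial a _](_ : _ = fun=> 0) //; apply/funext => x; exact: derive_cst.
Qed.

Lemma Ck_onD k U u v : open U ->
  Ck_on k U u -> Ck_on k U v -> Ck_on k U (fun x => u x + v x).
Proof.
move=> oU; elim: k u v => [|k IH] u v Cu Cv.
  split=> // x Ux.
  exact: cvgD (Ck_on_continuous Cu Ux) (Ck_on_continuous Cv Ux).
have [_ Hu] := Cu; have [_ Hv] := Cv; apply: Ck_onS => [x Ux|a].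
  exact: cvgD (Ck_on_continuous Cu Ux) (Ck_on_continuous Cv Ux).
have [du Hu'] := Hu a; have [dv Hv'] := Hv a; split=> [x Ux|].
  exact: derivableD (du _ Ux) (dv _ Ux).
apply: Ck_on_ext oU _ (IH _ _ Hu' Hv') => x Ux.
by rewrite /partial -deriveD //; [exact: du|exact: dv].
Qed.

Lemma Ck_onM k U u v : open U ->
  Ck_on k U u -> Ck_on k U v -> Ck_on k U (fun x => u x * v x).
Proof.
move=> oU; elim: k u v => [|k IH] u v Cu Cv.
  split=> // x Ux.
  exact: cvgM (Ck_on_continuous Cu Ux) (Ck_on_continuous Cv Ux).
have [_ Hu] := Cu; have [_ Hv] := Cv; apply: Ck_onS => [x Ux|a].
  exact: cvgM (Ck_on_continuous Cu Ux) (Ck_on_continuous Cv Ux).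
have [du Hu'] := Hu a; have [dv Hv'] := Hv a; split=> [x Ux|].
  exact: derivableM (du _ Ux) (dv _ Ux).
apply: Ck_on_ext oU _ (Ck_onD oU (IH _ _ (Ck_onW Cu) Hv') (IH _ _ (Ck_onW Cv) Hu')).
by move=> x Ux; rewrite /partial deriveM //; [exact: du|exact: dv].
Qed.

Lemma Ck_onV k U u : open U -> (forall x, U x -> u x != 0) ->
  Ck_on k U u -> Ck_on k U (fun x => (u x)^-1).
Proof.
move=> oU u0; elim: k => [|k IH] Cu.
  by split=> // x Ux; exact: cvgV (u0 _ Ux) (Ck_on_continuous Cu Ux).
have [_ Hu] := Cu; apply: Ck_onS => [x Ux|a].
  exact: cvgV (u0 _ Ux) (Ck_on_continuous Cu Ux).
have [du Hu'] := Hu a; split=> [x Ux|].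
  exact: derivableV (u0 _ Ux) (du _ Ux).
have CV := IH (Ck_onW Cu).
apply: Ck_on_ext oU _ (Ck_onM oU (Ck_on_cst k U (-1)) (Ck_onM oU (Ck_onM oU CV CV) Hu')).
move=> x Ux; rewrite /partial deriveV; [|exact: u0|exact: du].
by rewrite mulN1r scaleNr -invfM expr2.
Qed.

Lemma smooth_ext U u v : open U -> (forall y, U y -> u y = v y) ->
  smooth_on U u -> smooth_on U v.
Proof. by move=> oU uv Su k; exact: Ck_on_ext oU uv (Su k). Qed.

Lemma smooth_cst U (c : R) : smooth_on U (fun=> c).
Proof. by move=> k; exact: Ck_on_cst. Qed.

Lemma smoothD U u v : open U -> smooth_on U u -> smooth_on U v ->
  smooth_on U (fun x => u x + v x).
Proof. by move=> oU Su Sv k; exact: Ck_onD. Qed.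

Lemma smoothM U u v : open U -> smooth_on U u -> smooth_on U v ->
  smooth_on U (fun x => u x * v x).
Proof. by move=> oU Su Sv k; exact: Ck_onM. Qed.

Lemma smoothN U u : open U -> smooth_on U u -> smooth_on U (fun x => - u x).
Proof.
move=> oU Su; apply: smooth_ext oU _ (smoothM oU (smooth_cst U (-1)) Su).
by move=> y _; rewrite mulN1r.
Qed.

Lemma smoothB U u v : open U -> smooth_on U u -> smooth_on U v ->
  smooth_on U (fun x => u x - v x).
Proof. by move=> oU Su Sv; apply: smoothD oU Su (smoothN oU Sv). Qed.

Lemma smoothV U u : open U -> (forall x, U x -> u x != 0) -> smooth_on U u ->
  smooth_on U (fun x => (u x)^-1).
Proof. by move=> oU u0 Su k; exact: Ck_onV. Qed.

Lemma smooth_sum U (F : 'I_2 -> 'rV[R]_2 -> R) : open U ->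
  (forall a, smooth_on U (F a)) -> smooth_on U (fun x => \sum_a F a x).
Proof.
move=> oU SF; apply: smooth_ext oU _ (smoothD oU (SF 0) (SF 1)).
by move=> x _; rewrite sum_ord2.
Qed.

Lemma smooth_partial U u a : smooth_on U u -> smooth_on U (partial a u).
Proof. by move=> Su k; have [_ /(_ a)[]] := Su k.+1. Qed.

Lemma smooth_continuous U u x : smooth_on U u -> U x -> {for x, continuous u}.
Proof. by move=> /(_ 0%N)[+ _]; exact. Qed.

Lemma smooth_derivable U u x a : smooth_on U u -> U x ->
  derivable u x (delta_mx 0 a).
Proof. by move=> /(_ 1%N)[_ /(_ a)[+ _]]; exact. Qed.

Lemma smooth_differentiable U u x : open U -> smooth_on U u -> U x ->
  differentiable u x /\
  forall v : 'rV[R]_2, 'd u x v = v 0 0 * partial 0 u x + v 0 1 * partial 1 u x.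
Proof.
move=> oU Su Ux; apply: differentiable_partials.
  by apply: near_open oU Ux _ => y Uy a; exact: smooth_derivable Su Uy.
by move=> a; exact: smooth_continuous (smooth_partial a Su) Ux.
Qed.

Lemma partialD U u v x a : smooth_on U u -> smooth_on U v -> U x ->
  partial a (fun y => u y + v y) x = partial a u x + partial a v x.
Proof.
by move=> Su Sv Ux; rewrite /partial -deriveD //;
  [exact: smooth_derivable Su Ux|exact: smooth_derivable Sv Ux].
Qed.

Lemma partialM U u v x a : smooth_on U u -> smooth_on U v -> U x ->
  partial a (fun y => u y * v y) x = partial a u x * v x + u x * partial a v x.
Proof.
move=> Su Sv Ux; rewrite /partial deriveM; first by rewrite addrC mulrC.
  exact: smooth_derivable Su Ux.
exact: smooth_derivable Sv Ux.
Qed.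

Lemma partial_sum U (F : 'I_2 -> 'rV[R]_2 -> R) x a : open U ->
  (forall b, smooth_on U (F b)) -> U x ->
  partial a (fun y => \sum_b F b y) x = \sum_b partial a (F b) x.
Proof.
move=> oU SF Ux; rewrite sum_ord2 -(partialD a (SF 0) (SF 1) Ux).
by apply: partial_ext oU Ux _ => y _; rewrite sum_ord2.
Qed.

Lemma is_derive_lineP (V W : normedModType R) (f : V -> W) (x v : V) (d : W) :
  is_derive x v f d <-> is_derive (0 : R) 1 (fun h => f (h *: v + x)) d.
Proof.
set g : R -> W := fun h => f (h *: v + x).
have E : (fun h : R => h^-1 *: ((g \o shift 0) (h *: 1) - g 0)) =
  (fun h : R => h^-1 *: ((f \o shift x) (h *: v) - f x)).
  by apply/funext => h /=; rewrite /g scale0r add0r addr0 [h%:A]mulr1.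
by split=> -[D D']; split; move: D D'; rewrite /derivable /derive E.
Qed.

(** The outer function is scalar, so a directional derivative of [u] suffices: restriction to the
    line through [x] reduces this to the chain rule in one variable. *)
Lemma is_derive_scalar_comp (V : normedModType R) (u : V -> R) (phi : R -> R)
    (x v : V) (a b : R) :
  is_derive x v u b -> is_derive (u x) 1 phi a ->
  is_derive x v (fun z => phi (u z)) (a * b).
Proof.
move=> /is_derive_lineP du dphi; apply/is_derive_lineP.
by apply: is_derive1_comp; rewrite scale0r add0r.
Qed.

Lemma ler_dist_half (p q s e : R) :
  `|p - q| < e / 2 -> `|q - s| < e / 2 -> `|p - s| <= e.
Proof.
move=> pq qs; rewrite -(subrKA q) (le_trans (ler_normD _ _)) //.
by rewrite [leRHS]splitr lerD ?ltW.
Qed.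

(** The second difference is symmetric in the two directions, so the two mixed partials take a
    common value at points [y] and [z] near [x]. Continuity at [x] then leaves a difference of at
    most any [e]. *)
Lemma partial_comm U u x a b : open U -> smooth_on U u -> U x ->
  partial a (partial b u) x = partial b (partial a u) x.
Proof.
move=> oU Su Ux; have [->//|ab] := eqVneq a b.
apply/eqP; rewrite -subr_eq0 -normr_le0; apply/ler_addgt0Pr => e e0; rewrite add0r.
have e2 : 0 < e / 2 by rewrite divr_gt0.
have [r0 r00 hr0] := open_ball_sub oU Ux.
have C c d : exists2 r : R, 0 < r & forall y, ball x r y ->
    `|partial c (partial d u) x - partial c (partial d u) y| < e / 2.
  have := smooth_continuous (smooth_partial c (smooth_partial d Su)) Ux.
  by move=> /cvgrPdist_lt/(_ _ e2)/nbhs_ballP[r ? h]; exists r.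
have [r1 r10 h1] := C a b; have [r2 r20 h2] := C b a.
pose r := Num.min r0 (Num.min r1 r2).
have rpos : 0 < r by rewrite !lt_min r00 r10.
have [t0 tr] : 0 < r / 2 /\ r / 2 < r by split; lra.
have Br y : ball x r y -> [/\ ball x r0 y, ball x r1 y & ball x r2 y].
  move=> /ball2P xy; split; apply/ball2P => c; have := xy c;
  by rewrite !lt_min => /and3P[].
have du c y : ball x r y -> derivable u y (delta_mx 0 c).
  by move=> /Br[/hr0 Uy _ _]; exact: smooth_derivable Su Uy.
have ddu c d y : ball x r y -> derivable (partial c u) y (delta_mx 0 d).
  by move=> /Br[/hr0 Uy _ _]; exact: smooth_derivable (smooth_partial c Su) Uy.
have [y xy Ey] := mixed_difference t0 tr ab (du a) (ddu a b).
rewrite eq_sym in ab.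
have [z xz Ez] := mixed_difference t0 tr ab (du b) (ddu b a).
have yz : partial b (partial a u) y = partial a (partial b u) z.
  apply: (@mulfI _ (r / 2 * (r / 2))); first by rewrite mulf_neq0 ?gt_eqF.
  have ba := addrCA ((r / 2) *: delta_mx 0 b) ((r / 2) *: delta_mx 0 a) x.
  by apply: (etrans (esym Ey)); apply: (etrans _ Ez); rewrite ba; congr (_ + _); rewrite addrAC.
have [_ _ /h2 H2] := Br _ xy; have [_ /h1 H1 _] := Br _ xz.
by rewrite yz distrC in H2; exact: ler_dist_half H1 H2.
Qed.

End SmoothFunctions.

(** * Curvature and soliton equation in a chart *)

Section TensorAlgebra.
Variable R : realType.
Implicit Types (H : 'I_2 -> 'I_2 -> R) (g dH : 'I_2 -> 'I_2 -> 'I_2 -> R)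
  (dg : 'I_2 -> 'I_2 -> 'I_2 -> 'I_2 -> R) (X F : 'I_2 -> R).

(** In this section everything is evaluated at one point and derivatives are independent unknowns:
    [H] is the metric, [dH] its derivatives, [g] the Christoffel symbols (upper index first), [dg]
    their derivatives (direction first), [F] and [FF] the first and second partials of the
    potential, [X] its gradient. In these unknowns [curv] is the endomorphism R(e_0, e_1). *)
Definition curv g dg (m c : 'I_2) : R :=
  dg 0 m 1 c - dg 1 m 0 c + \sum_k (g m 0 k * g k 1 c - g m 1 k * g k 0 c).

(** The premise equates the two mixed second derivatives of the metric component [c d], expanded by
    metric compatibility. Once [dH] is eliminated the same way, the difference of the two sides is
    exactly the symmetrized curvature. *)
Lemma curv_antisymmetric g dg H c d : (forall a b, H a b = H b a) ->
  (forall dH, (forall a b c, dH a b c = \sum_d (g d a b * H d c + g d a c * H b d)) ->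
   \sum_m ((dg 0 m 1 c * H m d + g m 1 c * dH 0 m d) +
           (dg 0 m 1 d * H c m + g m 1 d * dH 0 c m)) =
   \sum_m ((dg 1 m 0 c * H m d + g m 0 c * dH 1 m d) +
           (dg 1 m 0 d * H c m + g m 0 d * dH 1 c m))) ->
  \sum_m (curv g dg m c * H m d + curv g dg m d * H m c) = 0.
Proof.
move=> Hs /(_ (fun a b c => \sum_d (g d a b * H d c + g d a c * H b d))) E.
have {E} := E (fun a b c => erefl); rewrite /curv !sum_ord2.
rewrite !(Hs c) (Hs 1 0); move=> E; apply/eqP; move/eqP: E.
rewrite -subr_eq0 => /eqP E; rewrite -{}E; apply/eqP.
move: (Hs 0 d) (Hs 1 d) => -> ->.
ring.
Qed.

(** Endomorphisms of the plane that are skew for a nondegenerate metric form a line, and the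
    definition of K fixes the point on it. Each entry comes from eliminating the others after
    multiplication by the determinant [D]. *)
Lemma solve_curvature (h00 h01 h11 r00 r01 r10 r11 K D : R) :
  D = h00 * h11 - h01 * h01 -> D != 0 ->
  K * D = h00 * r01 + h01 * r11 ->
  r00 * h00 + r10 * h01 = 0 -> r01 * h01 + r11 * h11 = 0 ->
  r00 * h01 + r10 * h11 + (r01 * h00 + r11 * h01) = 0 ->
  [/\ r00 = K * h01, r10 = - (K * h00), r01 = K * h11 & r11 = - (K * h01)].
Proof.
move=> DE D0 KE E0 E1 E01.
have E2 : r00 * h01 + r10 * h11 = - (K * D).
  by rewrite KE; apply/eqP; rewrite -subr_eq0 -E01; apply/eqP; ring.
split; apply: (mulfI D0); rewrite DE.
- transitivity (h11 * (r00 * h00 + r10 * h01) - h01 * (r00 * h01 + r10 * h11)).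
    by ring.
  by rewrite E0 E2 DE; ring.
- transitivity (h00 * (r00 * h01 + r10 * h11) - h01 * (r00 * h00 + r10 * h01)).
    by ring.
  by rewrite E0 E2 DE; ring.
- transitivity (h11 * (h00 * r01 + h01 * r11) - h01 * (r01 * h01 + r11 * h11)).
    by ring.
  by rewrite E1 -KE DE; ring.
- transitivity (h00 * (r01 * h01 + r11 * h11) - h01 * (h00 * r01 + h01 * r11)).
    by ring.
  by rewrite E1 -KE DE; ring.
Qed.

Lemma lower_contract g H X F a b : (forall a b, H a b = H b a) ->
  (forall a, F a = \sum_c H a c * X c) ->
  \sum_d g d a b * F d = \sum_e X e * (\sum_d H e d * g d a b).
Proof. by move=> Hs FE; rewrite !sum_ord2 !FE !sum_ord2 (Hs 1 0); ring. Qed.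

(** This is the identity that the Lie derivative of the metric along grad f is twice the Hessian.
    The terms in [dX] disappear by differentiating df = g(grad f, .), and symmetry of [FF] accounts
    for the factor two. *)
Lemma lie_gradient_algebra g dH H X F (dX FF : 'I_2 -> 'I_2 -> R) a b :
  (forall a b, H a b = H b a) ->
  (forall a b, FF a b = FF b a) ->
  (forall a b, FF b a = \sum_c (dH b a c * X c + H a c * dX b c)) ->
  (forall e a b, \sum_d H e d * g d a b =
     2^-1 * (dH a b e + dH b a e - dH e a b)) ->
  (forall a, F a = \sum_c H a c * X c) ->
  \sum_c (X c * dH c a b + H c b * dX a c + H a c * dX b c) =
  2 * (FF a b - \sum_d g d a b * F d).
Proof.
move=> Hs FFs FFE gE FE; rewrite (lower_contract g a b Hs FE).
have -> : 2 * (FF a b - \sum_e X e * (\sum_d H e d * g d a b)) =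
    FF a b + FF b a - 2 * \sum_e X e * (\sum_d H e d * g d a b).
  by rewrite (FFs b a); ring.
rewrite !FFE (sum_ord2 (fun e => X e * _)) !gE !sum_ord2.
by rewrite (Hs 0 b) (Hs 1 b); field.
Qed.

(** The premise equates the mixed third derivatives of the potential after its Hessian has been
    replaced by [mu] times the metric, where the differential of [mu] is minus that of K. What
    survives is the curvature applied to df. *)
Lemma codazzi_algebra g dg H dH (FF : 'I_2 -> 'I_2 -> R) F (K0 K1 mu : R) c :
  (forall a b, H a b = H b a) ->
  (forall c a b, g c a b = g c b a) ->
  (forall a b c, dH a b c = \sum_d (g d a b * H d c + g d a c * H b d)) ->
  (forall a b, FF a b = \sum_d g d a b * F d + mu * H a b) ->
  \sum_d (dg 0 d 1 c * F d + g d 1 c * FF 0 d) + (- K0 * H 1 c + mu * dH 0 1 c) =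
  \sum_d (dg 1 d 0 c * F d + g d 0 c * FF 1 d) + (- K1 * H 0 c + mu * dH 1 0 c) ->
  \sum_d curv g dg d c * F d = K0 * H 1 c - K1 * H 0 c.
Proof.
move=> Hs gs dHE FFE; rewrite /curv !sum_ord2 !FFE !dHE !sum_ord2.
move=> /eqP; rewrite -subr_eq0 => /eqP E.
apply/eqP; rewrite -subr_eq0 -{}E; apply/eqP.
rewrite (gs 0 1 0) (gs 1 1 0) (Hs 1 0); ring.
Qed.

Lemma solve_codazzi (h00 h01 h11 F0 F1 K K0 K1 : R) :
  h00 * h11 - h01 * h01 != 0 ->
  K * h01 * F0 + - (K * h00) * F1 = K0 * h01 - K1 * h00 ->
  K * h11 * F0 + - (K * h01) * F1 = K0 * h11 - K1 * h01 ->
  K0 = K * F0 /\ K1 = K * F1.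
Proof.
move=> D0 /eqP; rewrite -subr_eq0 => /eqP E0 /eqP; rewrite -subr_eq0 => /eqP E1.
split; apply: (mulfI D0); apply/eqP; rewrite -subr_eq0; apply/eqP.
- transitivity (h01 * (K * h01 * F0 + - (K * h00) * F1 - (K0 * h01 - K1 * h00)) -
    h00 * (K * h11 * F0 + - (K * h01) * F1 - (K0 * h11 - K1 * h01))); first by ring.
  by rewrite E0 E1; ring.
- transitivity (h11 * (K * h01 * F0 + - (K * h00) * F1 - (K0 * h01 - K1 * h00)) -
    h01 * (K * h11 * F0 + - (K * h01) * F1 - (K0 * h11 - K1 * h01))); first by ring.
  by rewrite E0 E1; ring.
Qed.

(** In coordinates this is d|grad f|^2 = 2 Hess f(grad f, .), specialized to a Hessian equal to [mu]
    times the metric. *)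
Lemma grad_norm_algebra g dH H X F (dX FF : 'I_2 -> 'I_2 -> R) mu c :
  (forall a b, H a b = H b a) ->
  (forall c a b, dH c a b = dH c b a) ->
  (forall a b, FF b a = \sum_c (dH b a c * X c + H a c * dX b c)) ->
  (forall e a b, \sum_d H e d * g d a b =
     2^-1 * (dH a b e + dH b a e - dH e a b)) ->
  (forall a, F a = \sum_c H a c * X c) ->
  (forall a b, FF a b = \sum_d g d a b * F d + mu * H a b) ->
  \sum_a (dX c a * F a + X a * FF c a) = 2 * mu * F c.
Proof.
move=> Hs dHs FFE gE FE HE.
have E1 : \sum_a dX c a * F a =
    \sum_b X b * (FF c b - \sum_a dH c b a * X a).
  by rewrite !sum_ord2 !FE !sum_ord2 !FFE !sum_ord2 (Hs 1 0); ring.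
have HE' a b : FF a b =
    \sum_e X e * (2^-1 * (dH a b e + dH b a e - dH e a b)) + mu * H a b.
  rewrite HE (lower_contract g a b Hs FE); congr (_ + _).
  by apply: eq_bigr => e _; rewrite gE.
by rewrite big_split /= {}E1 !sum_ord2 !HE' FE !sum_ord2 (dHs c 1 0); field.
Qed.

End TensorAlgebra.

(** * Metric, curvature and potential in a single chart *)

Section LocalGeometry.
Variable R : realType.
Implicit Types (A : 'M[R]_2) (v w x y : 'rV[R]_2).

Lemma qformE A v w : (v *m A *m w^T) 0 0 = \sum_a \sum_b v 0 a * A a b * w 0 b.
Proof.
rewrite mxE exchange_big /=; apply: eq_bigr => b _.
by rewrite !mxE mulr_suml.
Qed.

Lemma qformZ A v (c : R) :
  ((c *: v) *m A *m (c *: v)^T) 0 0 = c ^+ 2 * (v *m A *m v^T) 0 0.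
Proof. by rewrite !qformE !sum_ord2 !mxE; ring. Qed.

Lemma det2E A : \det A = A 0 0 * A 1 1 - A 0 1 * A 1 0.
Proof.
rewrite (expand_det_row _ 0) sum_ord2 /cofactor !det_mx11 !mxE /=.
have -> : lift 0 0 = 1 :> 'I_2 by apply: val_inj.
have -> : lift 1 0 = 0 :> 'I_2 by apply: val_inj.
by rewrite /= expr0 expr1 !mul1r mulN1r mulrN.
Qed.

Lemma posdef_diag_det A : A^T = A ->
  (forall v, v != 0 -> 0 < (v *m A *m v^T) 0 0) -> 0 < A 0 0 /\ 0 < \det A.
Proof.
move=> As Ap; have A10 : A 1 0 = A 0 1 by rewrite -[in LHS]As mxE.
have A00 : 0 < A 0 0.
  have := Ap (delta_mx 0 0); rewrite qformE !sum_ord2 !mxE /=.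
  rewrite !mul0r !mulr0 !addr0 !mulr1 mul1r; apply.
  by apply/eqP => /(congr1 (fun M : 'rV[R]_2 => M 0 0)); rewrite !mxE /= => /eqP; rewrite oner_eq0.
split=> //.
(* On this vector, orthogonal to the first basis vector, the form takes the value
   [A 0 0 * \det A]. *)
pose v : 'rV[R]_2 := \row_b (if b == 0 then - A 0 1 else A 0 0).
have v0 : v 0 0 = - A 0 1 by rewrite mxE.
have v1 : v 0 1 = A 0 0 by rewrite mxE.
have := Ap v; rewrite qformE !sum_ord2 v0 v1 A10 det2E A10.
have -> : - A 0 1 * A 0 0 * - A 0 1 + - A 0 1 * A 0 1 * A 0 0 +
    (A 0 0 * A 0 1 * - A 0 1 + A 0 0 * A 1 1 * A 0 0) =
    A 0 0 * (A 0 0 * A 1 1 - A 0 1 * A 0 1) by ring.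
rewrite pmulr_rgt0 //; apply.
by apply/eqP => /(congr1 (fun M : 'rV[R]_2 => M 0 1)); rewrite v1 mxE => E; rewrite E ltxx in A00.
Qed.

Lemma inv_mulK A (T : 'I_2 -> R) e : A \in unitmx ->
  \sum_d A e d * (\sum_m invmx A d m * T m) = T e.
Proof.
move=> uA; have := congr1 (fun M : 'cV[R]_2 => M e 0) (mulKVmx uA (\col_m T m)).
rewrite !mxE => <-; apply: eq_bigr => d _; congr (_ * _).
by rewrite mxE; apply: eq_bigr => m _; rewrite mxE.
Qed.

(** Cramer's rule, with indicators in place of a case analysis on [c], so that smoothness of the
    inverse metric follows from that of products, sums and the reciprocal determinant. *)
Lemma invmx2E A c d : \det A != 0 ->
  invmx A c d = ((c == 0)%:R * (if d == 0 then A 1 1 else - A 0 1) +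
                 (c == 1)%:R * (if d == 0 then - A 1 0 else A 0 0)) * (\det A)^-1.
Proof.
move=> D0; have uA : A \in unitmx by rewrite unitmxE unitfE.
have E k : invmx A c 0 * A 0 k + invmx A c 1 * A 1 k = (c == k)%:R.
  have := congr1 (fun M : 'M[R]_2 => M c k) (mulVmx uA).
  by rewrite !mxE sum_ord2.
apply: (mulIf D0); rewrite divfK // -(E 0) -(E 1) det2E.
by elim/ord2P : d => /=; ring.
Qed.

Section Metric.
Variables (h : 'rV[R]_2 -> 'M[R]_2) (U : set 'rV[R]_2).
Hypothesis oU : open U.
Hypothesis smooth_h : forall a b, smooth_on U (fun x => h x a b).
Hypothesis sym_h : forall x, U x -> (h x)^T = h x.
Hypothesis pos_h : forall x v, U x -> v != 0 -> 0 < (v *m h x *m v^T) 0 0.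

Let hC x a b : U x -> h x a b = h x b a.
Proof. by move=> Ux; rewrite -[in LHS](sym_h Ux) mxE. Qed.

Let hpos x : U x -> 0 < h x 0 0 /\ 0 < \det (h x).
Proof. by move=> Ux; apply: posdef_diag_det (sym_h Ux) (fun v => pos_h Ux). Qed.

Lemma det_metric_neq0 x : U x -> \det (h x) != 0.
Proof. by move=> /hpos[_ /lt0r_neq0]. Qed.

Lemma metric_unit x : U x -> h x \in unitmx.
Proof. by move=> /det_metric_neq0; rewrite unitmxE unitfE. Qed.

Lemma partial_metricC a b c x : U x ->
  partial c (fun y => h y a b) x = partial c (fun y => h y b a) x.
Proof. by move=> Ux; apply: partial_ext oU Ux _ => y; exact: hC. Qed.

Lemma smooth_det : smooth_on U (fun x => \det (h x)).
Proof.
have S := smoothB oU (smoothM oU (smooth_h 0 0) (smooth_h 1 1))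
  (smoothM oU (smooth_h 0 1) (smooth_h 1 0)).
by apply: smooth_ext oU _ S => y _; rewrite det2E.
Qed.

Lemma smooth_invmx c d : smooth_on U (fun x => invmx (h x) c d).
Proof.
have S1 : smooth_on U (fun x => if d == 0 then h x 1 1 else - h x 0 1).
  by case: eqP => _; [|apply: smoothN].
have S2 : smooth_on U (fun x => if d == 0 then - h x 1 0 else h x 0 0).
  by case: eqP => _; [apply: smoothN|].
have S := smoothM oU (smoothD oU (smoothM oU (smooth_cst _ (c == 0)%:R) S1)
  (smoothM oU (smooth_cst _ (c == 1)%:R) S2)) (smoothV oU det_metric_neq0 smooth_det).
by apply: smooth_ext oU _ S => y Uy; rewrite invmx2E ?det_metric_neq0.
Qed.

Lemma smooth_christoffel c a b : smooth_on U (christoffel h c a b).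
Proof.
apply: smoothM oU (smooth_cst _ _) _; apply: smooth_sum => // d.
apply: smoothM oU (smooth_invmx _ _) _.
by apply: smoothB => //; [apply: smoothD => //|]; apply: smooth_partial.
Qed.

Lemma smooth_riemann d c a b : smooth_on U (riemann h d c a b).
Proof.
apply: smoothD => //.
  by apply: smoothB => //; apply: smooth_partial; apply: smooth_christoffel.
apply: smooth_sum => // m.
by apply: smoothB => //; apply: smoothM => //; apply: smooth_christoffel.
Qed.

Lemma smooth_curvature : smooth_on U (local_gauss_curvature h).
Proof.
apply: smoothM => //; last exact: smoothV oU det_metric_neq0 smooth_det.
by apply: smooth_sum => // d; apply: smoothM => //; apply: smooth_riemann.
Qed.

Lemma christoffelC c a b x : U x -> christoffel h c a b x = christoffel h c b a x.
Proof.
move=> Ux; rewrite /christoffel; congr (_ * _); apply: eq_bigr => d _.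
by congr (_ * (_ - _)); [rewrite addrC|exact: partial_metricC].
Qed.

Lemma lower_christoffel e a b x : U x ->
  \sum_d h x e d * christoffel h d a b x =
  2^-1 * (partial a (fun y => h y b e) x + partial b (fun y => h y a e) x
          - partial e (fun y => h y a b) x).
Proof.
move=> Ux; rewrite -(inv_mulK (fun m => partial a (fun y => h y b m) x +
  partial b (fun y => h y a m) x - partial m (fun y => h y a b) x) e (metric_unit Ux)).
by rewrite mulr_sumr; apply: eq_bigr => d _; rewrite /christoffel mulrCA.
Qed.

Lemma metric_compatible a b c x : U x ->
  partial a (fun y => h y b c) x =
  \sum_d (christoffel h d a b x * h x d c + christoffel h d a c x * h x b d).
Proof.
move=> Ux; rewrite big_split /=.
have -> : \sum_d christoffel h d a b x * h x d c = \sum_d h x c d * christoffel h d a b x.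
  by apply: eq_bigr => d _; rewrite mulrC hC.
have -> : \sum_d christoffel h d a c x * h x b d = \sum_d h x b d * christoffel h d a c x.
  by apply: eq_bigr => d _; rewrite mulrC.
rewrite !lower_christoffel // (partial_metricC c b a Ux).
by move: (partial _ _ _) (partial _ _ _) (partial _ _ _) => p q r; field.
Qed.

Lemma riemannE m c x : riemann h m c 0 1 x =
  curv (fun m a b => christoffel h m a b x)
       (fun e m a b => partial e (christoffel h m a b) x) m c.
Proof. by []. Qed.

Lemma riemann_antisymmetric c d x : U x ->
  \sum_m (riemann h m c 0 1 x * h x m d + riemann h m d 0 1 x * h x m c) = 0.
Proof.
move=> Ux; under eq_bigr do rewrite !riemannE.
apply: (@curv_antisymmetric _ _ _ (fun a b => h x a b)) => [a b|dH dHE]; first exact: hC.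
have E e e' : partial e' (partial e (fun y => h y c d)) x =
    \sum_m (partial e' (christoffel h m e c) x * h x m d +
      christoffel h m e c x * dH e' m d +
      (partial e' (christoffel h m e d) x * h x c m +
       christoffel h m e d x * dH e' c m)).
  have SG m a b := smooth_christoffel m a b.
  rewrite (partial_ext e' oU Ux (fun y => @metric_compatible e c d y)).
  rewrite (partial_sum e' oU _ Ux); last first.
    by move=> m; apply: smoothD => //; apply: smoothM.
  apply: eq_bigr => m _.
  rewrite (partialD e' (smoothM oU (SG _ _ _) (smooth_h _ _))
    (smoothM oU (SG _ _ _) (smooth_h _ _)) Ux).
  rewrite (partialM e' (SG _ _ _) (smooth_h _ _) Ux).
  rewrite (partialM e' (SG _ _ _) (smooth_h _ _) Ux).
  by rewrite !dHE !metric_compatible.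
have := partial_comm 0 1 oU (smooth_h c d) Ux.
by rewrite !E.
Qed.

Lemma riemann_curvature x : U x ->
  let K := local_gauss_curvature h x in
  [/\ riemann h 0 0 0 1 x = K * h x 0 1, riemann h 1 0 0 1 x = - (K * h x 0 0),
      riemann h 0 1 0 1 x = K * h x 1 1 & riemann h 1 1 0 1 x = - (K * h x 0 1)].
Proof.
move=> Ux K.
have D0 := det_metric_neq0 Ux.
have A c d := riemann_antisymmetric c d Ux.
apply: (solve_curvature _ D0).
- by rewrite det2E (hC 1 0 Ux).
- by rewrite /K /local_gauss_curvature divfK // sum_ord2 (hC 1 0 Ux).
- have := A 0 0; rewrite sum_ord2 (hC 1 0 Ux) => /eqP.
  rewrite addrACA -mulr2n mulrn_eq0 /= => /eqP; exact.
- have := A 1 1; rewrite sum_ord2 => /eqP.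
  rewrite addrACA -mulr2n mulrn_eq0 /= => /eqP; exact.
- by have := A 0 1; rewrite sum_ord2 (hC 1 0 Ux) addrACA.
Qed.

Lemma riemann_alternate m c a b x : riemann h m c a b x = - riemann h m c b a x.
Proof.
rewrite /riemann opprD opprB; congr (_ + _).
by rewrite -sumrN; apply: eq_bigr => k _; rewrite opprB.
Qed.

Lemma riemann_diag m c a x : riemann h m c a a x = 0.
Proof. by rewrite /riemann subrr add0r big1 // => k _; rewrite subrr. Qed.

Lemma ricci_curvature b c x : U x ->
  ricci h b c x = local_gauss_curvature h x * h x b c.
Proof.
move=> Ux; have [r00 r10 r01 r11] := riemann_curvature Ux.
elim/ord2P : b; elim/ord2P : c; rewrite /ricci sum_ord2 riemann_diag ?add0r ?addr0.
- by rewrite riemann_alternate r10 opprK.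
- by rewrite riemann_alternate r11 opprK.
- by rewrite r00 (hC 1 0 Ux).
- by rewrite r01.
Qed.

Definition gradient_norm2 (f : 'rV[R]_2 -> R) x : R :=
  \sum_a gradient h f a x * partial a f x.

Section Soliton.
Variables (f : 'rV[R]_2 -> R) (lambda : R).
Hypothesis smooth_f : smooth_on U f.
Hypothesis soliton : forall x, U x -> forall a b,
  - 2 * ricci h a b x = lie_derivative h (gradient h f) a b x - 2 * lambda * h x a b.

Local Notation K := (local_gauss_curvature h).
Local Notation N := (gradient_norm2 f).

Lemma smooth_gradient a : smooth_on U (gradient h f a).
Proof.
apply: smooth_sum => // b; apply: smoothM => //; first exact: smooth_invmx.
exact: smooth_partial.
Qed.

Lemma lower_gradient a x : U x ->
  partial a f x = \sum_c h x a c * gradient h f c x.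
Proof. by move=> Ux; rewrite (inv_mulK (fun m => partial m f x) a (metric_unit Ux)). Qed.

Lemma partial_lower_gradient a b x : U x ->
  partial b (partial a f) x =
  \sum_c (partial b (fun y => h y a c) x * gradient h f c x +
          h x a c * partial b (gradient h f c) x).
Proof.
move=> Ux; rewrite (partial_ext b oU Ux (lower_gradient a)).
rewrite (partial_sum b oU _ Ux); last by move=> c; apply: smoothM => //; exact: smooth_gradient.
by apply: eq_bigr => c _; rewrite (partialM b (smooth_h a c) (smooth_gradient c) Ux).
Qed.

(** Ric = K g and the identity for the Lie derivative turn the soliton equation into Hess f =
    (lambda - K) g. It is solved for the second partials so that it can be differentiated again as
    an identity of functions on [U]. *)
Lemma soliton_hessian a b x : U x ->
  partial a (partial b f) x =
  \sum_d christoffel h d a b x * partial d f x + (lambda - K x) * h x a b.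
Proof.
move=> Ux; have := soliton Ux a b; rewrite ricci_curvature //.
rewrite /lie_derivative (@lie_gradient_algebra _ (fun c a b => christoffel h c a b x)
  (fun c a b => partial c (fun y => h y a b) x) (fun a b => h x a b)
  (fun a => gradient h f a x) (fun a => partial a f x)
  (fun a b => partial a (gradient h f b) x)
  (fun a b => partial a (partial b f) x)); first last.
- by move=> d; exact: lower_gradient.
- by move=> e c d; exact: lower_christoffel.
- by move=> c d; exact: partial_lower_gradient.
- by move=> c d; exact: partial_comm oU smooth_f Ux.
- by move=> c d; exact: hC.
move: (\sum_(d < 2) _) (partial _ _ _) (K x) (h x a b) => S FF k g E.
apply: (@mulfI _ 2); first by rewrite pnatr_eq0.
have -> : 2 * FF = 2 * (FF - S) - 2 * lambda * g + 2 * S + 2 * lambda * g by ring.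
by rewrite -E; ring.
Qed.

(** Differentiating the Hessian equation expresses the third partials of f through dK and the
    Christoffel symbols; [E] is that expansion. Equating the two orders of differentiation gives two
    linear equations for dK, one for each [c], with the metric determinant as determinant. *)
Lemma curvature_gradient a x : U x -> partial a K x = K x * partial a f x.
Proof.
move=> Ux.
have SG m c d := smooth_christoffel m c d.
have SK := smooth_curvature.
have SP c := smooth_partial c smooth_f.
have E c e e' : partial e' (partial e (partial c f)) x =
    \sum_d (partial e' (christoffel h d e c) x * partial d f x +
            christoffel h d e c x * partial e' (partial d f) x) +
    (- partial e' K x * h x e c +
     (lambda - K x) * partial e' (fun y => h y e c) x).
  rewrite (partial_ext e' oU Ux (fun y => @soliton_hessian e c y)).
  have S1 : smooth_on U (fun y => lambda - K y).
    by apply: smoothB => //; exact: smooth_cst.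
  rewrite (partialD e' (smooth_sum oU (fun d => smoothM oU (SG d e c) (SP d)))
    (smoothM oU S1 (smooth_h _ _)) Ux).
  rewrite (partial_sum e' oU (fun d => smoothM oU (SG d e c) (SP d)) Ux).
  congr (_ + _).
    by apply: eq_bigr => d _; rewrite (partialM e' (SG d e c) (SP d) Ux).
  rewrite (partialM e' S1 (smooth_h _ _) Ux).
  congr (_ * _ + _).
  rewrite (partialD e' (smooth_cst _ lambda) (smoothN oU SK) Ux).
  rewrite [partial e' (fun=> lambda) x]derive_cst add0r.
  by apply: deriveN; exact: smooth_derivable SK Ux.
have C c : \sum_d riemann h d c 0 1 x * partial d f x =
    partial 0 K x * h x 1 c - partial 1 K x * h x 0 c.
  under eq_bigr do rewrite riemannE.
  apply: (@codazzi_algebra _ (fun m a b => christoffel h m a b x)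
    (fun e m a b => partial e (christoffel h m a b) x) (fun a b => h x a b)
    (fun c a b => partial c (fun y => h y a b) x)
    (fun a b => partial a (partial b f) x) (fun a => partial a f x)
    (partial 0 K x) (partial 1 K x) (lambda - K x)).
  - by move=> *; exact: hC.
  - by move=> *; exact: christoffelC.
  - by move=> *; exact: metric_compatible.
  - by move=> *; exact: soliton_hessian.
  exact: (etrans (esym (E c 1 0)) (etrans (partial_comm 0 1 oU (SP c) Ux) (E c 0 1))).
have [r00 r10 r01 r11] := riemann_curvature Ux.
have := C 1; have := C 0; rewrite !sum_ord2 r00 r10 r01 r11 (hC 1 0 Ux).
move=> C0 C1; have [] := solve_codazzi _ C0 C1; last by elim/ord2P : a.
by have := det_metric_neq0 Ux; rewrite det2E (hC 1 0 Ux).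
Qed.

Lemma smooth_gradient_norm2 : smooth_on U N.
Proof.
apply: smooth_sum => // a; apply: smoothM => //; first exact: smooth_gradient.
exact: smooth_partial.
Qed.

Lemma partial_gradient_norm2 c x : U x ->
  partial c N x = 2 * (lambda - K x) * partial c f x.
Proof.
move=> Ux; have SP a := smooth_partial a smooth_f.
rewrite (partial_sum c oU (fun a => smoothM oU (smooth_gradient a) (SP a)) Ux).
under eq_bigr => a _ do rewrite (partialM c (smooth_gradient a) (SP a) Ux).
apply: (@grad_norm_algebra _ (fun c a b => christoffel h c a b x)
  (fun c a b => partial c (fun y => h y a b) x) (fun a b => h x a b)
  (fun a => gradient h f a x) (fun a => partial a f x)
  (fun a b => partial a (gradient h f b) x)
  (fun a b => partial a (partial b f) x)).
- by move=> *; exact: hC.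
- by move=> *; exact: partial_metricC.
- by move=> *; exact: partial_lower_gradient.
- by move=> *; exact: lower_christoffel.
- by move=> *; exact: lower_gradient.
- by move=> *; exact: soliton_hessian.
Qed.

(** The differentials vanish: d(K e^(-f)) = e^(-f) (dK - K df), and d(N + 2 K - 2 lambda f) = 2
    (lambda - K) df + 2 K df - 2 lambda df. The conclusion is confined to a ball because a chart
    image may be disconnected. *)
Lemma soliton_first_integrals x : U x -> exists r : R, [/\ 0 < r, ball x r `<=` U &
  forall y, ball x r y ->
    K y * expR (- f y) = K x * expR (- f x) /\
    N y + 2 * K y - 2 * lambda * f y = N x + 2 * K x - 2 * lambda * f x].
Proof.
move=> Ux; have [r r0 rU] := open_ball_sub oU Ux; exists r; split=> // y xy.
have dK z a : U z -> is_derive z (delta_mx 0 a) K (K z * partial a f z).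
  move=> Uz; split; first exact: smooth_derivable smooth_curvature Uz.
  exact: curvature_gradient.
have df z a : U z -> is_derive z (delta_mx 0 a) f (partial a f z).
  by move=> Uz; split; first exact: smooth_derivable smooth_f Uz.
have dN z a : U z -> is_derive z (delta_mx 0 a) N (2 * (lambda - K z) * partial a f z).
  move=> Uz; split; first exact: smooth_derivable smooth_gradient_norm2 Uz.
  exact: partial_gradient_norm2.
split.
  apply: (@constant_on_ball _ x r (fun y => K y * expR (- f y)) _ y xy) => z /rU Uz a.
  have dKz := dK z a Uz; have dfz := df z a Uz.
  have dE : is_derive z (delta_mx 0 a) (fun y => expR (- f y))
      (expR (- f z) * - partial a f z).
    exact: (is_derive_scalar_comp (is_deriveN dfz) (is_derive_expR _)).
  have [D1 D2] := is_deriveM dKz dE.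
  split; first exact: D1.
  rewrite /partial [LHS]D2 -![_ *: _]/(_ * _) -/(partial a f z).
  by move: (partial a f z) (K z) (expR _) => p q s; ring.
apply: (@constant_on_ball _ x r (fun y => N y + 2 * K y - 2 * lambda * f y) _ y xy).
move=> z /rU Uz a.
have dKz := dK z a Uz; have dfz := df z a Uz; have dNz := dN z a Uz.
have [D1 D2] := is_deriveB (is_deriveD dNz (is_deriveZ 2 dKz)) (is_deriveZ (2 * lambda) dfz).
split; first exact: D1.
rewrite /partial [LHS]D2 -![_ *: _]/(_ * _) -/(partial a f z).
by move: (partial a f z) (K z) => p q; ring.
Qed.

(** Where f is constant the Hessian equation reads 0 = (lambda - K) g, and [h x 0 0] is positive.
    This is the degenerate case in the comparison of curvatures between charts. *)
Lemma curvature_of_constant_potential (W : set 'rV[R]_2) x : open W -> W x ->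
  W `<=` U -> (forall y, W y -> f y = f x) -> K x = lambda.
Proof.
move=> oW Wx WU fc.
have p0 a y : W y -> partial a f y = 0.
  move=> Wy; rewrite (@partial_ext _ W f (fun=> f x)) //.
  exact: derive_cst.
have := soliton_hessian 0 0 (WU _ Wx).
rewrite (@partial_ext _ W (partial 0 f) (fun=> 0)) //; last exact: p0.
rewrite [partial 0 _ x]derive_cst sum_ord2 !p0 // !mulr0 !add0r => /esym/eqP.
have [h00 _] := hpos (WU _ Wx).
by rewrite mulf_eq0 (gt_eqF h00) orbF subr_eq0 eq_sym => /eqP.
Qed.

End Soliton.

End Metric.

End LocalGeometry.

(** * Passing to the surface *)

Section Charts.
Variables (R : realType) (M : surface R).
Implicit Types (i j : atlas_index M) (p q : M) (x y : 'rV[R]_2).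

Lemma chart_cod_open_atlas i : open (chart_cod (atlas i)).
Proof. exact: chart_cod_open. Qed.

Lemma chart_cod_map i p : chart_dom (atlas i) p -> chart_cod (atlas i) (atlas i p).
Proof. by move=> ip; exists p. Qed.

Lemma chart_inv_dom i x : chart_cod (atlas i) x -> chart_dom (atlas i) (chart_inv (atlas i) x).
Proof. by move=> [p ip <-]; rewrite chart_mapK. Qed.

Lemma chart_invK i x : chart_cod (atlas i) x -> atlas i (chart_inv (atlas i) x) = x.
Proof. by move=> [p ip <-]; rewrite chart_mapK. Qed.

Lemma chart_continuous i p : chart_dom (atlas i) p -> {for p, continuous (atlas i)}.
Proof.
move=> ip; have := @chart_map_continuous _ _ (atlas i).
rewrite continuous_open_subspace; last exact: chart_dom_open.
by apply; rewrite inE.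
Qed.

Lemma chart_inv_continuous_at i x : chart_cod (atlas i) x ->
  {for x, continuous (chart_inv (atlas i))}.
Proof.
move=> ix; have := @chart_inv_continuous _ _ (atlas i).
rewrite continuous_open_subspace; last exact: chart_cod_open.
by apply; rewrite inE.
Qed.

Lemma near_chart i p (P : 'rV[R]_2 -> Prop) : chart_dom (atlas i) p ->
  (\forall x \near atlas i p, P x) ->
  \forall q \near p, chart_dom (atlas i) q /\ P (atlas i q).
Proof.
move=> ip nP; apply: filterI; last exact: (chart_continuous ip) nP.
by apply: open_nbhs_nbhs; split; [exact: chart_dom_open|].
Qed.

Lemma near_chart_inv i x (P : M -> Prop) : chart_cod (atlas i) x ->
  (\forall q \near chart_inv (atlas i) x, P q) ->
  \forall y \near x, chart_cod (atlas i) y /\ P (chart_inv (atlas i) y).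
Proof.
move=> ix nP; apply: filterI; last exact: (chart_inv_continuous_at ix) nP.
by apply: open_nbhs_nbhs; split; [exact: chart_cod_open_atlas|].
Qed.

Lemma index_atP p : chart_dom (atlas (index_at p)) p.
Proof. exact: (svalP (cid (atlas_cover p))). Qed.

Lemma overlap_open i j : open (overlap (atlas i) (atlas j)).
Proof.
rewrite openE => x [p [ip jp] <-]; rewrite /interior.
have nj : \forall q \near chart_inv (atlas i) (atlas i p), chart_dom (atlas j) q.
  by rewrite chart_mapK //; apply: open_nbhs_nbhs; split; [exact: chart_dom_open|].
apply: filterS (near_chart_inv (chart_cod_map ip) nj) => y [iy jy].
exists (chart_inv (atlas i) y); last exact: chart_invK.
by split=> //; exact: chart_inv_dom.
Qed.

Lemma overlap_map i j p : chart_dom (atlas i) p -> chart_dom (atlas j) p ->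
  overlap (atlas i) (atlas j) (atlas i p).
Proof. by move=> ip jp; exists p. Qed.

Lemma transition_map i j p : chart_dom (atlas i) p ->
  transition (atlas i) (atlas j) (atlas i p) = atlas j p.
Proof. by move=> ip; rewrite /transition chart_mapK. Qed.

Lemma differentiable_row2 (V : normedModType R) (F : V -> 'rV[R]_2) (z : V) :
  (forall b, differentiable (fun z => F z 0 b) z) -> differentiable F z.
Proof.
move=> dF.
rewrite [F](_ : _ = (fun z => F z 0 0 *: delta_mx 0 0) \+ (fun z => F z 0 1 *: delta_mx 0 1)).
  by apply: differentiableD; apply: differentiableZl.
by apply/funext => w /=; rewrite -row2E.
Qed.

Lemma derive_comp_diff (V W X : normedModType R) (F : V -> W) (G : W -> X) (z v : V) :
  differentiable F z -> differentiable G (F z) ->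
  'D_v (G \o F) z = 'd G (F z) ('D_v F z).
Proof.
move=> dF dG; rewrite deriveE; last exact: differentiable_comp.
by rewrite diff_comp //= deriveE.
Qed.

Lemma transition_differentiable i j p : chart_dom (atlas i) p -> chart_dom (atlas j) p ->
  differentiable (transition (atlas i) (atlas j)) (atlas i p).
Proof.
move=> ip jp; apply: differentiable_row2 => b.
have := smooth_differentiable (@overlap_open i j) (atlas_smooth i j b) (overlap_map ip jp).
by case.
Qed.

Lemma locally_constant_connected (T : Type) (F : M -> T) :
  connected [set: M] -> (forall p, \forall q \near p, F q = F p) ->
  forall p q, F p = F q.
Proof.
move=> cM lF p q.
have oF (P : set T) : open [set r | P (F r)].
  by rewrite openE => r Pr; rewrite /interior; apply: filterS (lF r) => s /= ->.
suff E : [set r | F r = F q] = [set: M] by have : [set: M] p by []; rewrite -E.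
apply: cM.
- by exists q.
- exists [set r | F r = F q]; last by rewrite setTI.
  exact: (oF (fun t => t = F q)).
- exists [set r | F r = F q]; last by rewrite setTI.
  by rewrite -openC; exact: (oF (fun t => t <> F q)).
Qed.

Section Soliton.
Variables (g : riemannian_metric M) (f : M -> R) (lambda : R).
Hypothesis smooth_f : smooth_function f.
Hypothesis soliton : forall i x, chart_cod (atlas i) x -> forall a b : 'I_2,
    - 2 * ricci (g i) a b x =
    lie_derivative (g i) (gradient (g i) (f \o chart_inv (atlas i))) a b x
    - 2 * lambda * g i x a b.

Definition chart_potential i := f \o chart_inv (atlas i).

Definition chart_curvature i p := local_gauss_curvature (g i) (atlas i p).

Definition chart_gradient_norm2 i p :=
  gradient_norm2 (g i) (chart_potential i) (atlas i p).

Lemma chart_potential_map i p : chart_dom (atlas i) p ->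
  chart_potential i (atlas i p) = f p.
Proof. by move=> ip; rewrite /chart_potential /= chart_mapK. Qed.

Lemma metric_smooth_chart i a b :
  smooth_on (chart_cod (atlas i)) (fun x => g i x a b).
Proof. exact: metric_smooth. Qed.

Lemma metric_unit_chart i x : chart_cod (atlas i) x -> g i x \in unitmx.
Proof. exact: (metric_unit (h := g i) (U := chart_cod (atlas i)) (@Defs.metric_sym _ _ g i) (@Defs.metric_pos _ _ g i)). Qed.

Lemma gradient_norm2E i p : let x := atlas i p in
  let df := \row_a partial a (chart_potential i) x in
  chart_gradient_norm2 i p = (df *m invmx (g i x) *m df^T) 0 0.
Proof.
move=> x df; rewrite qformE /chart_gradient_norm2 /gradient_norm2 /gradient !sum_ord2 !mxE.
by move: (partial _ _ _) (partial _ _ _) (invmx _ _ _) (invmx _ _ _) (invmx _ _ _) (invmx _ _ _) => *; ring.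
Qed.

Lemma potential_differentiable i p : chart_dom (atlas i) p ->
  differentiable (chart_potential i) (atlas i p) /\
  forall v, 'd (chart_potential i) (atlas i p) v =
    v 0 0 * partial 0 (chart_potential i) (atlas i p) +
    v 0 1 * partial 1 (chart_potential i) (atlas i p).
Proof.
move=> ip; exact: smooth_differentiable (@chart_cod_open_atlas i) (smooth_f i) (chart_cod_map ip).
Qed.

Lemma differential_transition i j p : chart_dom (atlas i) p -> chart_dom (atlas j) p ->
  \row_a partial a (chart_potential i) (atlas i p) =
  (\row_a partial a (chart_potential j) (atlas j p)) *m
    ('J (transition (atlas i) (atlas j)) (atlas i p))^T.
Proof.
move=> ip jp; set tau := transition _ _; set x := atlas i p.
have [dj djE] := potential_differentiable jp.
have dtau := transition_differentiable ip jp.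
have taux : tau x = atlas j p by exact: transition_map.
apply/rowP => a; rewrite !mxE.
have -> : partial a (chart_potential i) x = 'D_(delta_mx 0 a) (chart_potential j \o tau) x.
  apply: near_eq_derive; apply: (near_open (@overlap_open i j) (overlap_map ip jp)).
  move=> y [q [iq jq] <-].
  by rewrite chart_potential_map //= /tau transition_map // chart_potential_map.
have dj' : differentiable (chart_potential j) (tau x) by rewrite taux.
have D : 'D_(delta_mx 0 a) (chart_potential j \o tau) x =
    'd (chart_potential j) (tau x) ('D_(delta_mx 0 a) tau x).
  exact: (derive_comp_diff _ dtau dj').
rewrite D taux djE deriveEjacobian // sum_ord2 -rowE !mxE.
by rewrite mulrC [X in _ + X]mulrC.
Qed.

(** With J the Jacobian, df picks up J^T while the metric of chart [i] is J h J^T; the claim reduces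
    to J^T (J h J^T)^(-1) J = h^(-1). *)
Lemma chart_gradient_norm2_eq i j p : chart_dom (atlas i) p -> chart_dom (atlas j) p ->
  chart_gradient_norm2 i p = chart_gradient_norm2 j p.
Proof.
move=> ip jp; rewrite !gradient_norm2E (differential_transition ip jp).
have uj := metric_unit_chart (chart_cod_map jp).
have := metric_unit_chart (chart_cod_map ip).
have := metric_tensor g (overlap_map ip jp); rewrite /= transition_map // => ->.
set J := jacobian _ _; set h := g j _; set df := \row_a _ => ui.
(* Invertibility of the Jacobian is read off from that of the metric J h J^T, with no appeal to the
   inverse transition map. *)
have uJ : J \in unitmx.
  by move: ui; rewrite !unitmxE !det_mulmx !unitrM => /andP[/andP[]].
have uJT : J^T \in unitmx by rewrite unitmx_tr.
have E1 : J^T *m invmx (J *m h *m J^T) *m J *m h *m J^T = J^T.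
  by rewrite -!mulmxA (mulmxA J) mulVmx // mulmx1.
have E2 : J^T *m invmx (J *m h *m J^T) *m J *m h = 1%:M.
  by rewrite -[LHS](mulmxK uJT) E1 mulmxV.
have -> : df *m J^T *m invmx (J *m h *m J^T) *m (df *m J^T)^T =
    df *m (J^T *m invmx (J *m h *m J^T) *m J) *m df^T.
  by rewrite trmx_mul trmxK !mulmxA.
by rewrite -[J^T *m _ *m _](mulmxK uj) E2 mul1mx.
Qed.

Lemma chart_first_integrals i p : chart_dom (atlas i) p ->
  \forall q \near p, chart_dom (atlas i) q /\
    (chart_curvature i q * expR (- f q) = chart_curvature i p * expR (- f p) /\
     chart_gradient_norm2 i q + 2 * chart_curvature i q - 2 * lambda * f q =
     chart_gradient_norm2 i p + 2 * chart_curvature i p - 2 * lambda * f p).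
Proof.
move=> ip.
have [r [r0 _ H]] := soliton_first_integrals (@chart_cod_open_atlas i)
  (metric_smooth_chart i) (@Defs.metric_sym _ _ g i) (@Defs.metric_pos _ _ g i)
  (smooth_f i) (@soliton i) (chart_cod_map ip).
have := near_chart ip (nbhsx_ballx (atlas i p) r r0).
apply: filterS => q [iq /H[E1 E2]]; split=> //.
by rewrite -!(chart_potential_map ip) -!(chart_potential_map iq).
Qed.

Lemma chart_curvature_constant_potential i p : chart_dom (atlas i) p ->
  (\forall q \near p, f q = f p) -> chart_curvature i p = lambda.
Proof.
move=> ip fc.
have := near_chart_inv (chart_cod_map ip); rewrite chart_mapK // => /(_ _ fc).
rewrite -nbhs_nearE => /nbhs_ballP[r r0 H].
apply: (@curvature_of_constant_potential _ (g i) _ (@chart_cod_open_atlas i)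
  (metric_smooth_chart i) (@Defs.metric_sym _ _ g i) (@Defs.metric_pos _ _ g i)
  (f \o chart_inv (atlas i)) _ (smooth_f i) (@soliton i) (ball (atlas i p) r)°).
- exact: open_interior.
- exact: nbhsx_ballx.
- by move=> y /interior_subset/H[].
- by move=> y /interior_subset/H[_ E]; rewrite /= E chart_mapK.
Qed.

(* If the two values differed, subtracting the first integrals of the two charts
   would make f constant near p, and then both equal lambda. *)
Lemma chart_curvature_eq i j p : chart_dom (atlas i) p -> chart_dom (atlas j) p ->
  chart_curvature i p = chart_curvature j p.
Proof.
move=> ip jp; apply: contrapT => Kij; apply: (Kij).
suff fc : \forall q \near p, f q = f p.
  by rewrite !chart_curvature_constant_potential.
apply: filterS2 (chart_first_integrals ip) (chart_first_integrals jp).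
move=> q [iq [Ei Ei']] [jq [Ej Ej']].
rewrite (chart_gradient_norm2_eq iq jq) (chart_gradient_norm2_eq ip jp) in Ei'.
(* The gradient norms cancel, so by the second integrals the difference of the two curvatures is the
   same at [q] as at [p]; by the first integrals so is its product with e^(-f). *)
have : (chart_curvature i p - chart_curvature j p) * expR (- f p) =
    (chart_curvature i p - chart_curvature j p) * expR (- f q).
  rewrite mulrBl -Ei -Ej -mulrBl; congr (_ * _).
  move: Ei' Ej'; move: (chart_gradient_norm2 _ _) (chart_gradient_norm2 _ _)
    (chart_curvature _ _) (chart_curvature _ _) (chart_curvature _ _) (chart_curvature _ _)
    (lambda) => *; lra.
move=> /mulfI; rewrite subr_eq0 => /(_ (introN eqP Kij)) /expR_inj /oppr_inj.
by [].
Qed.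

(** [F] reads both integrals in the chart selected at each point, and that choice can jump. Chart
    independence is what makes [F] locally constant, hence constant by connectedness. *)
Lemma global_first_integrals : connected [set: M] -> exists k C : R,
  forall i p, chart_dom (atlas i) p ->
    chart_curvature i p = k * expR (f p) /\
    chart_gradient_norm2 i p + 2 * k * expR (f p) - 2 * lambda * f p = C.
Proof.
move=> cM.
(* The surface may be empty, and then there is no base point from which to read the constants. *)
have [[p0 _]|M0] := pselect (exists p : M, True); last first.
  by exists 0, 0 => i p; case: M0; exists p.
pose F p := (chart_curvature (index_at p) p * expR (- f p),
  chart_gradient_norm2 (index_at p) p + 2 * chart_curvature (index_at p) p
  - 2 * lambda * f p).
have Fc : forall p q, F p = F q.
  apply: locally_constant_connected cM _ => p.
  apply: filterS (chart_first_integrals (index_atP p)) => q [iq [E1 E2]].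
  rewrite /F (chart_curvature_eq (index_atP q) iq).
  by rewrite (chart_gradient_norm2_eq (index_atP q) iq) E1 E2.
exists (F p0).1, (F p0).2 => i p ip; rewrite (Fc p0 p) /F /=.
rewrite (chart_curvature_eq (index_atP p) ip) (chart_gradient_norm2_eq (index_atP p) ip).
have E : expR (- f p) * expR (f p) = 1 by rewrite -expRD addNr expR0.
by rewrite -!mulrA E !mulr1.
Qed.

End Soliton.

End Charts.

(** * Curves and lengths *)

Section Arcs.
Variables (R : realType) (M : surface R) (g : riemannian_metric M).
Implicit Types (i j : atlas_index M) (p q : M) (x y : 'rV[R]_2) (gamma : R -> M) (t s : R).

(* Unlike [ge0_le_integral], this needs no measurability, because the integral
   of a nonnegative function is a supremum over simple functions below it. *)
Lemma ge0_le_integral_nonmeasurable (D : set R) (u v : R -> \bar R) :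
  (forall t, D t -> (0 <= u t)%E /\ (u t <= v t)%E) ->
  (\int[lebesgue_measure]_(t in D) u t <= \int[lebesgue_measure]_(t in D) v t)%E.
Proof.
move=> uv.
rewrite ge0_integralE; last by move=> t /uv[].
rewrite ge0_integralE; last by move=> t /uv[u0 uv']; exact: le_trans uv'.
apply: le_ereal_sup => _ [h hu <-]; exists h => // t.
apply: le_trans (hu t) _; apply: lee_restrict => {}t Dt.
exact: (uv t Dt).2.
Qed.

(** The difference of the two sides is [\det A] times the square of [v 0 0 * X 0 1 - v 0 1 * X 0 0].
    With [X] the gradient it bounds df(v)^2 by |grad f|^2 |v|^2. *)
Lemma quadratic_form_cauchy_schwarz (A : 'M[R]_2) (v X : 'rV[R]_2) :
  A^T = A -> 0 <= \det A ->
  (\sum_a v 0 a * (\sum_c A a c * X 0 c)) ^+ 2 <=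
  (\sum_a X 0 a * (\sum_c A a c * X 0 c)) * (v *m A *m v^T) 0 0.
Proof.
move=> As; rewrite det2E => D0.
have A10 : A 1 0 = A 0 1 by rewrite -[in LHS]As mxE.
rewrite qformE -subr_ge0 !sum_ord2 A10.
rewrite A10 in D0; move: D0.
move: (A 0 0) (A 0 1) (A 1 1) (v 0 0) (v 0 1) (X 0 0) (X 0 1) => a b c v0 v1 X0 X1 D0.
rewrite (_ : _ - _ = (a * c - b * b) * (v0 * X1 - v1 * X0) ^+ 2); last by ring.
by rewrite mulr_ge0 // sqr_ge0.
Qed.

Lemma derive_curve_comp (V W : normedModType R) (c : R -> V) (G : V -> W) t :
  differentiable c t -> differentiable G (c t) ->
  'D_1 (G \o c) t = 'd G (c t) ('D_1 c t).
Proof. exact: derive_comp_diff. Qed.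

Lemma is_derive_reverse (V : normedModType R) (c : R -> V) t :
  derivable c (1 - t) 1 ->
  is_derive t 1 (fun s => c (1 - s)) (- derive1 c (1 - t)).
Proof.
move=> dc; have dc' := (derivable1_diffP _ _).1 dc.
pose m : R -> R := fun s => 1 - s.
have [dm1 dm2] : is_derive t 1 m (0 - 1) by exact: is_deriveB.
have dm' := (derivable1_diffP _ _).1 dm1.
have dcm : differentiable (c \o m) t by exact: differentiable_comp dm' dc'.
have E : 'D_1 (c \o m) t = - derive1 c (1 - t).
  by rewrite (derive_curve_comp dm' dc') dm2 sub0r linearN derive1E (deriveE _ dc').
exact: (DeriveDef ((derivable1_diffP _ _).2 dcm) E).
Qed.

Definition C1_at gamma t : Prop := {for t, continuous gamma} /\
  forall i, chart_dom (atlas i) (gamma t) ->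
    derivable (atlas i \o gamma) t 1 /\
    {for t, continuous (derive1 (atlas i \o gamma))}.

Section Arc.
Variables (gamma : R -> M) (J : set R).
Hypotheses (oJ : open J) (J01 : `[0, 1] `<=` J).
Hypothesis C1J : forall t, J t -> C1_at gamma t.

Definition velocity i t : 'rV[R]_2 := derive1 (atlas i \o gamma) t.

Lemma near_arc i t : J t -> chart_dom (atlas i) (gamma t) ->
  \forall s \near t, J s /\ chart_dom (atlas i) (gamma s).
Proof.
move=> Jt it; apply: filterI; first by apply: open_nbhs_nbhs.
apply: (C1J Jt).1; apply: open_nbhs_nbhs; split=> //; exact: chart_dom_open.
Qed.

Lemma arc_differentiable i t : J t -> chart_dom (atlas i) (gamma t) ->
  differentiable (atlas i \o gamma) t.
Proof.
move=> Jt it; have [di _] := (C1J Jt).2 i it.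
exact: ((derivable1_diffP _ _).1 di).
Qed.

Lemma velocity_transition i j t : J t ->
  chart_dom (atlas i) (gamma t) -> chart_dom (atlas j) (gamma t) ->
  velocity j t = velocity i t *m 'J (transition (atlas i) (atlas j)) (atlas i (gamma t)).
Proof.
move=> Jt it jt; rewrite /velocity !derive1E.
have dtau := transition_differentiable it jt.
rewrite -(deriveEjacobian _ dtau) (deriveE _ dtau).
rewrite -(derive_curve_comp (arc_differentiable Jt it) dtau).
apply: near_eq_derive; apply: filterS (near_arc Jt it) => s [Js is_] /=.
by rewrite transition_map.
Qed.

(** [speed] uses the chart selected at each point of the curve, which can jump. Since the Jacobians
    in velocity and metric cancel, one fixed chart serves near each parameter; continuity of the
    speed rests on this. *)
Lemma speedE i t : J t -> chart_dom (atlas i) (gamma t) ->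
  speed g gamma t =
  Num.sqrt ((velocity i t *m g i (atlas i (gamma t)) *m (velocity i t)^T) 0 0).
Proof.
move=> Jt it; rewrite /speed; set j := index_at (gamma t).
have jt : chart_dom (atlas j) (gamma t) by exact: index_atP.
rewrite -[derive1 _ t]/(velocity j t) (velocity_transition Jt it jt).
rewrite (metric_tensor g (overlap_map it jt)) /= transition_map //.
by rewrite trmx_mul !mulmxA.
Qed.

Lemma velocity_coord_continuous i t a : J t -> chart_dom (atlas i) (gamma t) ->
  {for t, continuous (fun s => velocity i s 0 a)}.
Proof.
move=> Jt it; have [_ cv] := (C1J Jt).2 i it.
exact: (continuous_comp cv (@coord_continuous R 1 2 0 a (velocity i t))).
Qed.

Lemma smooth_arc_continuous i t (u : 'rV[R]_2 -> R) : smooth_on (chart_cod (atlas i)) u ->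
  J t -> chart_dom (atlas i) (gamma t) ->
  {for t, continuous (fun s => u (atlas i (gamma s)))}.
Proof.
move=> Su Jt it.
have c1 := differentiable_continuous (arc_differentiable Jt it).
have c2 := smooth_continuous Su (chart_cod_map it).
exact: (continuous_comp c1 c2).
Qed.

Lemma speed_continuous t : J t -> {for t, continuous (speed g gamma)}.
Proof.
move=> Jt; pose i := index_at (gamma t).
have it : chart_dom (atlas i) (gamma t) by exact: index_atP.
pose Q s := \sum_a \sum_b velocity i s 0 a * g i (atlas i (gamma s)) a b * velocity i s 0 b.
have cQ : {for t, continuous Q}.
  have E : Q = fun s =>
     velocity i s 0 0 * g i (atlas i (gamma s)) 0 0 * velocity i s 0 0 +
     velocity i s 0 0 * g i (atlas i (gamma s)) 0 1 * velocity i s 0 1 +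
     (velocity i s 0 1 * g i (atlas i (gamma s)) 1 0 * velocity i s 0 0 +
      velocity i s 0 1 * g i (atlas i (gamma s)) 1 1 * velocity i s 0 1).
    by apply/funext => s; rewrite /Q !sum_ord2.
  have cv a := @velocity_coord_continuous i t a Jt it.
  have cg a b := smooth_arc_continuous (@Defs.metric_smooth _ _ g i a b) Jt it.
  have T a b := continuousM (continuousM (cv a) (cg a b)) (cv b).
  by rewrite E; exact: (continuousD (continuousD (T 0 0) (T 0 1)) (continuousD (T 1 0) (T 1 1))).
have cs : {for t, continuous (fun s => Num.sqrt (Q s))}.
  exact: (continuous_comp cQ (@sqrt_continuous R (Q t))).
have E s : J s -> chart_dom (atlas i) (gamma s) -> speed g gamma s = Num.sqrt (Q s).
  by move=> Js is_; rewrite (speedE Js is_) qformE.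
rewrite /prop_for /continuous_at (E t Jt it).
have nE : \forall s \near t, Num.sqrt (Q s) = speed g gamma s.
  by apply: filterS (near_arc Jt it) => s [Js is_]; rewrite E.
exact: cvg_trans (near_eq_cvg nE) cs.
Qed.

(** By the fundamental theorem of calculus the increment of [w] is the integral of [dw], whose
    absolute value the speed dominates pointwise. *)
Lemma arc_length_ge_variation (w dw : R -> R) :
  (forall t, J t -> is_derive t 1 w (dw t)) ->
  (forall t, J t -> {for t, continuous dw}) ->
  (forall t, J t -> `|dw t| <= speed g gamma t) ->
  (`|w 1 - w 0|%:E <= arc_length g gamma)%E.
Proof.
move=> dwE cdw dw_le.
have cdw01 : {within `[0, 1], continuous dw}.
  by apply: continuous_in_subspaceT => t; rewrite inE => /J01; exact: cdw.
have cw t : J t -> {for t, continuous w}.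
  move=> /dwE[dt _]; apply: differentiable_continuous; exact: ((derivable1_diffP _ _).1 dt).
have J0 : J 0 by apply: J01; rewrite /= in_itv /= lexx ler01.
have J1 : J 1 by apply: J01; rewrite /= in_itv /= lexx ler01.
have := @continuous_FTC2 R dw w 0 1 ltr01 cdw01.
rewrite -EFinB => E; rewrite -abse_EFin -E; last first.
- move=> t; rewrite in_itv /= => /andP[t0 t1]; rewrite derive1E.
  by apply: derive_val; apply: dwE; apply: J01; rewrite /= in_itv /= !ltW.
- split.
  + move=> t; rewrite in_itv /= => /andP[t0 t1].
    have Jt : J t by apply: J01; rewrite /= in_itv /= !ltW.
    by have [] := dwE t Jt.
  + exact: cvg_at_right_filter (cw 0 J0).
  + exact: cvg_at_left_filter (cw 1 J1).
apply: le_trans (le_abse_integral _ _ _) _ => //.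
  by apply/measurable_EFinP; exact: subspace_continuous_measurable_fun.
apply: ge0_le_integral_nonmeasurable => t /J01 Jt; split; first exact: abse_ge0.
by rewrite abse_EFin lee_fin; exact: dw_le.
Qed.

End Arc.

(** Paths in [joined] grow at their starting point only, so their symmetry, and with it the Cauchy
    condition for both orders of the indices, depends on reversing a single arc. *)
Lemma reverse_arc gamma : C1_arc gamma -> let rho := fun t => gamma (1 - t) in
  C1_arc rho /\ arc_length g rho = arc_length g gamma.
Proof.
move=> [J [oJ J01 C1J]] rho.
have conem : continuous (fun t : R => 1 - t).
  by move=> t; apply: cvgB; [exact: cvg_cst|exact: cvg_id].
have oJ' : open [set t | J (1 - t)].
  by rewrite -[X in open X]/((fun t : R => 1 - t) @^-1` J); apply: open_comp => // t _; exact: conem.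
have J'01 : `[0, 1] `<=` [set t | J (1 - t)].
  move=> t /=; rewrite in_itv /= => /andP[t0 t1]; apply: J01.
  by rewrite /= in_itv /= subr_ge0 t1 lerBlDr lerDl.
have C1J' t : J (1 - t) -> C1_at rho t.
  move=> Jt; have [cg dg] := C1J _ Jt; split.
    exact: (continuous_comp (conem t) cg).
  move=> i it; have [di ci] := dg i it; have [d1 d2] := is_derive_reverse di; split; first exact: d1.
  have E s : J (1 - s) -> chart_dom (atlas i) (gamma (1 - s)) ->
      derive1 (atlas i \o rho) s = - velocity gamma i (1 - s).
    move=> Js is_; have [di' _] := (C1J _ Js).2 i is_.
    by have [_ d2'] := is_derive_reverse di'; rewrite derive1E.
  have cc : {for t, continuous (fun s => - velocity gamma i (1 - s))}.
    by apply: cvgN; exact: (continuous_comp (conem t) ci).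
  rewrite /prop_for /continuous_at E //.
  have nE : \forall s \near t, - velocity gamma i (1 - s) = derive1 (atlas i \o rho) s.
    have : \forall s \near t, J (1 - s) /\ chart_dom (atlas i) (gamma (1 - s)).
      exact: (conem t) (near_arc oJ C1J Jt it).
    by apply: filterS => s [Js is_]; rewrite E.
  exact: cvg_trans (near_eq_cvg nE) cc.
split; first by exists [set t | J (1 - t)].
have cs : {within `[0, 1], continuous (speed g gamma)}.
  by apply: continuous_in_subspaceT => t; rewrite inE => /J01; exact: (speed_continuous oJ C1J).
have := @integration_by_substitution_onem R (speed g gamma) 1.
rewrite ler01 lexx => /(_ isT cs); rewrite /unstable.onem subrr => E.
apply: etrans (esym E); apply: eq_integral => t; rewrite inE => /J'01 Jt.
have it : chart_dom (atlas (index_at (rho t))) (gamma (1 - t)) := index_atP (rho t).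
rewrite (speedE oJ C1J Jt it) (speedE oJ' C1J' Jt it).
have [di _] := (C1J _ Jt).2 _ it.
have -> : velocity rho (index_at (rho t)) t = - velocity gamma (index_at (rho t)) (1 - t).
  by have [_ d2] := is_derive_reverse di; rewrite /velocity derive1E.
have trN (v : 'rV[R]_2) : (- v)^T = - v^T by apply/matrixP => a b; rewrite !mxE.
by rewrite trN mulmxN !mulNmx opprK.
Qed.

Lemma joined_cat p q r (l l' : \bar R) : joined g p q l -> joined g q r l' ->
  joined g p r (l + l')%E.
Proof.
move=> pq; elim: pq r l' => [{}p|gamma {}q {}l C1 _ IH] r l' qr.
  by rewrite add0e.
by rewrite -addeA; apply: joined_cons C1 _; exact: IH.
Qed.

Lemma joined_sym p q (l : \bar R) : joined g p q l -> joined g q p l.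
Proof.
elim=> [{}p|gamma {}q {}l C1 _ IH]; first exact: joined_refl.
have [C1r Lr] := reverse_arc C1.
rewrite addeC; apply: joined_cat IH _.
have := joined_cons C1r (joined_refl g _).
by rewrite adde0 Lr subr0 subrr.
Qed.

End Arcs.

(** * Straight coordinate segments as curves on the surface *)

Section Segments.
Variables (R : realType) (M : surface R) (g : riemannian_metric M).
Implicit Types (i j : atlas_index M) (p q : M) (x w : 'rV[R]_2) (gamma : R -> M) (t s : R).

Lemma is_derive_line x w t : is_derive t 1 (fun s => s *: w + x) w.
Proof.
have [d1 d2] : is_derive (t *: w + x) w (@id 'rV[R]_2) w := is_derive_id _ _.
exact: (is_derive_eq (line_is_derive d1) d2).
Qed.

Lemma line_differentiable x w t : differentiable (fun s => s *: w + x) t.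
Proof. by have [d _] := is_derive_line x w t; exact: ((derivable1_diffP _ _).1 d). Qed.

Lemma line_continuous x w : continuous (fun s => s *: w + x).
Proof. by move=> t; apply: differentiable_continuous; exact: line_differentiable. Qed.

Section Segment.
Variables (i : atlas_index M) (x w : 'rV[R]_2).
Let gamma t := chart_inv (atlas i) (t *: w + x).
Let J : set R := [set t | chart_cod (atlas i) (t *: w + x)].

Lemma segment_open : open J.
Proof.
rewrite -[J]/((fun t => t *: w + x) @^-1` chart_cod (atlas i)).
apply: open_comp; last exact: chart_cod_open.
by move=> t _; exact: line_continuous.
Qed.

(** Regularity is required in every chart [j] met by the segment, where the curve is a line followed
    by a transition map; its velocity [DD] combines partials of that map, continuous by smoothness
    of the atlas. *)
Lemma segment_C1 t : J t -> C1_at gamma t.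
Proof.
move=> Jt; split.
  exact: (continuous_comp (@line_continuous x w t) (chart_inv_continuous_at Jt)).
move=> j jt.
have it : chart_dom (atlas i) (gamma t) by exact: chart_inv_dom.
have ot : overlap (atlas i) (atlas j) (t *: w + x).
  by rewrite -(chart_invK Jt); exact: overlap_map.
pose tau b y := transition (atlas i) (atlas j) y 0 b.
have St b : smooth_on (overlap (atlas i) (atlas j)) (tau b) by exact: atlas_smooth.
pose D b s := w 0 0 * partial 0 (tau b) (s *: w + x) + w 0 1 * partial 1 (tau b) (s *: w + x).
have dD b s : overlap (atlas i) (atlas j) (s *: w + x) ->
    is_derive s 1 (fun s => tau b (s *: w + x)) (D b s).
  move=> os; have [dtau dtauE] := smooth_differentiable (@overlap_open _ _ i j) (St b) os.
  have dl := line_differentiable x w s.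
  have dc := differentiable_comp dl dtau.
  have E := derive_curve_comp dl dtau.
  have [_ lE] := is_derive_line x w s.
  rewrite lE dtauE in E.
  exact: (DeriveDef ((derivable1_diffP _ _).2 dc) E).
have dM s : overlap (atlas i) (atlas j) (s *: w + x) -> derivable (atlas j \o gamma) s 1.
  move=> os; apply/derivable_mxP => a b; rewrite (ord1 a).
  by have [d _] := dD b s os; exact: d.
split; first exact: dM.
pose DD s : 'rV[R]_2 := D 0 s *: delta_mx 0 0 + D 1 s *: delta_mx 0 1.
have DE s : overlap (atlas i) (atlas j) (s *: w + x) -> derive1 (atlas j \o gamma) s = DD s.
  move=> os; rewrite derive1E derive_mx; last exact: dM.
  apply/rowP => b; rewrite !mxE.
  have [_ E] := dD b s os; rewrite [LHS]E.
  by elim/ord2P : b {E}; rewrite /= ?mulr1 ?mulr0 ?addr0 ?add0r.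
have cD b : {for t, continuous (D b)}.
  have cp a : {for t, continuous (fun s => partial a (tau b) (s *: w + x))}.
    exact: (continuous_comp (@line_continuous x w t) (smooth_continuous (smooth_partial a (St b)) ot)).
  exact: (continuousD (continuousM (@cst_continuous _ _ (w 0 0) t) (cp 0))
    (continuousM (@cst_continuous _ _ (w 0 1) t) (cp 1))).
have cDD : {for t, continuous DD}.
  by apply: cvgD; apply: cvgZr_tmp; exact: cD.
rewrite /prop_for /continuous_at DE //.
have nE : \forall s \near t, DD s = derive1 (atlas j \o gamma) s.
  have no := open_nbhs_nbhs (conj (@overlap_open _ _ i j) ot).
  have ns : \forall s \near t, overlap (atlas i) (atlas j) (s *: w + x).
    exact: (@line_continuous x w t _ no).
  by apply: filterS ns => s os; rewrite DE.
exact: cvg_trans (near_eq_cvg nE) cDD.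
Qed.

Lemma segment_velocity t : J t -> velocity gamma i t = w.
Proof.
move=> Jt; rewrite /velocity derive1E; have [_ lE] := is_derive_line x w t.
rewrite -[RHS]lE; apply: near_eq_derive.
apply: filterS (open_nbhs_nbhs (conj segment_open Jt)) => s Js.
exact: chart_invK.
Qed.

Lemma segment_joined (B : R) : 0 <= B ->
  (forall t, 0 <= t <= 1 -> chart_cod (atlas i) (t *: w + x) /\
     (w *m g i (t *: w + x) *m w^T) 0 0 <= B ^+ 2) ->
  exists2 l, joined g (chart_inv (atlas i) x) (chart_inv (atlas i) (w + x)) l &
    (l <= B%:E)%E.
Proof.
move=> B0 H.
have C1 : C1_arc gamma.
  exists J; split; [exact: segment_open| |exact: segment_C1].
  by move=> t; rewrite /= in_itv /= => /H[].
exists (arc_length g gamma).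
  have := joined_cons C1 (joined_refl g _).
  by rewrite adde0 /gamma scale0r add0r scale1r.
have -> : B%:E = (\int[lebesgue_measure]_(t in `[0%R, 1%R]) (cst B%:E t))%E :> \bar R.
  rewrite integral_cst //=; have := @lebesgue_measure_itv R `[0, 1]; rewrite /= => ->.
  by rewrite lte_fin ltr01 -EFinB subr0 mule1.
apply: ge0_le_integral_nonmeasurable => t /=; rewrite in_itv /= => /H[ct qt].
split; first by rewrite lee_fin sqrtr_ge0.
have Jt : J t by [].
have it : chart_dom (atlas i) (gamma t) by exact: chart_inv_dom.
rewrite lee_fin (speedE _ segment_open segment_C1 Jt it) segment_velocity // chart_invK //.
by rewrite -(ger0_norm B0) -sqrtr_sqr ler_wsqrtr.
Qed.

End Segment.

End Segments.

(** * Functions of the potential along curves *)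

Section PotentialVariation.
Variables (R : realType) (M : surface R) (g : riemannian_metric M).
Implicit Types (i j : atlas_index M) (p q : M) (x w : 'rV[R]_2) (gamma : R -> M) (t s : R).

Variables (f : M -> R) (phi dphi : R -> R).
Hypothesis smooth_f : smooth_function f.
Hypothesis dphiE : forall s, is_derive s 1 phi (dphi s).
Hypothesis dphi_continuous : continuous dphi.

Local Notation N := (chart_gradient_norm2 g f).
Local Notation df i p a := (partial a (chart_potential f i) (atlas i p)).

Lemma lower_gradient_chart i p a : chart_dom (atlas i) p ->
  df i p a = \sum_c g i (atlas i p) a c * gradient (g i) (chart_potential f i) c (atlas i p).
Proof.
move=> ip; exact: (@lower_gradient _ (g i) (chart_cod (atlas i)) (@Defs.metric_sym _ _ g i)
  (@Defs.metric_pos _ _ g i) (chart_potential f i) a _ (chart_cod_map ip)).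
Qed.

Lemma chart_differential_bound i p (v : 'rV[R]_2) : chart_dom (atlas i) p ->
  (v 0 0 * df i p 0 + v 0 1 * df i p 1) ^+ 2 <=
  N i p * (v *m g i (atlas i p) *m v^T) 0 0.
Proof.
move=> ip; have cx := chart_cod_map ip.
have [_ D0] := posdef_diag_det (Defs.metric_sym g cx) (fun v => @Defs.metric_pos _ _ g i _ v cx).
pose X : 'rV[R]_2 := \row_a gradient (g i) (chart_potential f i) a (atlas i p).
have := quadratic_form_cauchy_schwarz v X (Defs.metric_sym g cx) (ltW D0).
have FE a : \sum_c g i (atlas i p) a c * X 0 c = df i p a.
  by rewrite (lower_gradient_chart a ip); apply: eq_bigr => c _; rewrite mxE.
rewrite sum_ord2 !FE; congr (_ <= _ * _).
by apply: eq_bigr => a _; rewrite FE mxE.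
Qed.

Lemma chart_gradient_norm2_qform i p : chart_dom (atlas i) p ->
  let X : 'rV[R]_2 := \row_a gradient (g i) (chart_potential f i) a (atlas i p) in
  (X *m g i (atlas i p) *m X^T) 0 0 = N i p.
Proof.
move=> ip X; rewrite qformE; apply: eq_bigr => a _.
rewrite -[partial a _ _]/(df i p a) (lower_gradient_chart a ip) mulr_sumr.
by apply: eq_bigr => b _; rewrite !mxE mulrA.
Qed.

Lemma chart_gradient_norm2_ge0 i p : chart_dom (atlas i) p -> 0 <= N i p.
Proof.
move=> ip; rewrite -(chart_gradient_norm2_qform ip).
set X : 'rV[R]_2 := \row_a _; have [->|X0] := eqVneq X 0.
  by rewrite !mul0mx mxE.
exact: ltW (Defs.metric_pos g (chart_cod_map ip) X0).
Qed.

Lemma potential_arc gamma (J : set R) i t : open J ->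
  (forall t, J t -> C1_at gamma t) -> J t -> chart_dom (atlas i) (gamma t) ->
  is_derive t 1 (fun s => f (gamma s))
    (velocity gamma i t 0 0 * df i (gamma t) 0 + velocity gamma i t 0 1 * df i (gamma t) 1).
Proof.
move=> oJ C1J Jt it.
have [dfi dfiE] := potential_differentiable smooth_f it.
have dc := arc_differentiable C1J Jt it.
have dd := differentiable_comp dc dfi.
have E := derive_curve_comp dc dfi.
rewrite dfiE -(derive1E (atlas i \o gamma)) in E.
have ID := DeriveDef ((derivable1_diffP _ _).2 dd) E.
apply: near_eq_is_derive ID.
apply: filterS (near_arc oJ C1J Jt it) => s [Js is_].
by rewrite /= chart_potential_map.
Qed.

(** The second premise says that the gradient of [phi \o f] has norm at most one, so by
    Cauchy-Schwarz its rate of change along a curve is at most the speed. *)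
Lemma arc_variation gamma : C1_arc gamma ->
  (forall i p, chart_dom (atlas i) p -> dphi (f p) ^+ 2 * N i p <= 1) ->
  (`|phi (f (gamma 1)) - phi (f (gamma 0))|%:E <= arc_length g gamma)%E.
Proof.
move=> [J [oJ J01 C1J]] H.
pose D i t := dphi (f (gamma t)) *
  (velocity gamma i t 0 0 * df i (gamma t) 0 + velocity gamma i t 0 1 * df i (gamma t) 1).
have dD i t : J t -> chart_dom (atlas i) (gamma t) ->
    is_derive t 1 (fun s => phi (f (gamma s))) (D i t).
  move=> Jt it.
  exact: (is_derive_scalar_comp (potential_arc oJ C1J Jt it) (dphiE _)).
pose I t := index_at (gamma t).
have It t : chart_dom (atlas (I t)) (gamma t) by exact: index_atP.
pose w s := phi (f (gamma s)); pose dw s := D (I s) s.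
have dwE s : J s -> is_derive s 1 w (dw s) by move=> Js; exact: dD.
have cdw t : J t -> {for t, continuous dw}.
  move=> Jt; set i := I t.
  have cv a := @velocity_coord_continuous _ _ gamma J C1J i t a Jt (It t).
  have cp a := @smooth_arc_continuous _ _ gamma J C1J i t _ (smooth_partial a (smooth_f i)) Jt (It t).
  have cf : {for t, continuous (fun s => f (gamma s))}.
    have [d _] := potential_arc oJ C1J Jt (It t).
    exact: differentiable_continuous ((derivable1_diffP _ _).1 d).
  have cdf := continuous_comp cf (@dphi_continuous (f (gamma t))).
  have cD : {for t, continuous (D i)}.
    exact: (continuousM cdf (continuousD (continuousM (cv 0) (cp 0)) (continuousM (cv 1) (cp 1)))).
  (* [dw] changes chart with the parameter, but both sides are derivatives of the same function of
     [s], so they agree by uniqueness. *)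
  have nE : \forall s \near t, D i s = dw s.
    apply: filterS (near_arc oJ C1J Jt (It t)) => s [Js is_].
    have [_ E1] := dD i s Js is_; have [_ E2] := dwE s Js.
    exact: etrans (esym E1) E2.
  exact: cvg_trans (near_eq_cvg nE) cD.
have dw_le t : J t -> `|dw t| <= speed g gamma t.
  move=> Jt; rewrite (speedE _ oJ C1J Jt (It t)) -sqrtr_sqr ler_wsqrtr //.
  rewrite /dw /D exprMn.
  have q0 : 0 <= (velocity gamma (I t) t *m g (I t) (atlas (I t) (gamma t)) *m
      (velocity gamma (I t) t)^T) 0 0.
    have [->|v0] := eqVneq (velocity gamma (I t) t) 0; first by rewrite !mul0mx mxE.
    exact: ltW (Defs.metric_pos g (chart_cod_map (It t)) v0).
  apply: le_trans (ler_wpM2l (sqr_ge0 _) (chart_differential_bound _ (It t))) _.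
  by rewrite mulrA ler_piMl // H.
exact: (arc_length_ge_variation J01 dwE cdw dw_le).
Qed.

Lemma joined_variation p q (l : \bar R) : joined g p q l ->
  (forall i p, chart_dom (atlas i) p -> dphi (f p) ^+ 2 * N i p <= 1) ->
  (`|phi (f p) - phi (f q)|%:E <= l)%E.
Proof.
move=> pq H; elim: pq => [{}p|gamma {}q {}l C1 _ IH].
  by rewrite subrr normr0.
have A := arc_variation C1 H; apply: le_trans (leeD A IH).
rewrite -EFinD lee_fin [X in _ <= X + _]distrC.
by rewrite -[X in `|X| <= _](subrKA (phi (f (gamma 1)))) ler_normD.
Qed.

(** A short coordinate segment in the direction of grad f replaces a flow line. To first order in
    its size h, [phi \o f] drops by h d |grad f|^2 over a length h |grad f|. Granting half the drop
    and twice the length yields the factor 4. *)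
Lemma gradient_step i p (d : R) : chart_dom (atlas i) p -> 0 < d ->
  dphi (f p) = - d -> 0 < N i p -> exists q l,
  [/\ joined g p q l, phi (f q) < phi (f p) &
      (l <= (4 / (d * Num.sqrt (N i p)) * (phi (f p) - phi (f q)))%:E)%E].
Proof.
move=> ip d0 dE N0.
set x := atlas i p; have cx : chart_cod (atlas i) x := chart_cod_map ip.
set n := Num.sqrt (N i p); have n0 : 0 < n by rewrite sqrtr_gt0.
have nn : n ^+ 2 = N i p by rewrite sqr_sqrtr // ltW.
pose X : 'rV[R]_2 := \row_a gradient (g i) (chart_potential f i) a x.
pose Q y := (X *m g i y *m X^T) 0 0.
have Qx : Q x = n ^+ 2 by rewrite nn; exact: chart_gradient_norm2_qform.
have cQ : {for x, continuous Q}.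
  have E : Q = fun y => X 0 0 * g i y 0 0 * X 0 0 + X 0 0 * g i y 0 1 * X 0 1 +
      (X 0 1 * g i y 1 0 * X 0 0 + X 0 1 * g i y 1 1 * X 0 1).
    by apply/funext => y; rewrite /Q qformE !sum_ord2.
  have cg a b := smooth_continuous (@Defs.metric_smooth _ _ g i a b) cx.
  have c c := @cst_continuous 'rV[R]_2 R c x.
  have T a b := continuousM (continuousM (c (X 0 a)) (cg a b)) (c (X 0 b)).
  by rewrite E; exact: (continuousD (continuousD (T 0 0) (T 0 1)) (continuousD (T 1 0) (T 1 1))).
(* Within [r] of [x] the length of the fixed vector [X] is at most twice its length at [x]. *)
have [r r0 rP] : exists2 r : R, 0 < r & forall y, `|x - y| < r ->
    chart_cod (atlas i) y /\ Q y <= 4 * n ^+ 2.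
  have n1 := open_nbhs_nbhs (conj (@chart_cod_open_atlas _ _ i) cx).
  have n2 : \forall y \near x, Q y < 4 * n ^+ 2.
    have lt4 : Q x < 4 * n ^+ 2 by rewrite Qx; have := exprn_gt0 2 n0; lra.
    exact: cQ _ (open_nbhs_nbhs (conj (@open_lt R (4 * n ^+ 2)) lt4)).
  have /nbhs_ballP[r r0 H] : nbhs x [set y | chart_cod (atlas i) y /\ Q y < 4 * n ^+ 2].
    exact: filterI n1 n2.
  exists r => // y xy.
  have [|c1 c2] := H y; first by rewrite -ball_normE.
  by split=> //; exact: ltW.
pose U y := phi (chart_potential f i y).
have [e e0 eP] : exists2 e : R, 0 < e & forall h, 0 < h < e ->
    U (h *: X + x) - U x < - (h * (d * n ^+ 2 / 2)).
  have [dfi dfiE] := potential_differentiable smooth_f ip.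
  have dX : is_derive x X (chart_potential f i) (n ^+ 2).
    split; first exact: diff_derivable.
    rewrite (deriveE _ dfi) dfiE nn /chart_gradient_norm2 /gradient_norm2 sum_ord2.
    by rewrite !mxE.
  have dU : is_derive x X U (dphi (chart_potential f i x) * n ^+ 2).
    exact: is_derive_scalar_comp dX (dphiE _).
  rewrite chart_potential_map // dE in dU.
  case: dU => dU1 dU2.
  have lim : (fun h => h^-1 *: ((U \o shift x) (h *: X) - U x)) h @[h --> (0 : R)^'] -->
      - d * n ^+ 2.
    by rewrite -dU2; exact: dU1.
  have lt2 : - d * n ^+ 2 < - (d * n ^+ 2 / 2).
    have := mulr_gt0 d0 (exprn_gt0 2 n0); lra.
  have /= := lim _ (open_nbhs_nbhs (conj (@open_lt R (- (d * n ^+ 2 / 2))) lt2)).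
  move=> /nbhs_ballP[e e0 H]; exists e => // h /andP[h0 he].
  have := H h; rewrite /= -ball_normE /= sub0r normrN gtr0_norm // => /(_ he).
  move=> /(_ (lt0r_neq0 h0)); rewrite -[_ *: _]/(_ * _) mulrC ltr_pdivrMr // mulNr.
  by rewrite (mulrC h).
(* The first bound keeps [h] below [e], the second keeps the segment within [r] of [x]; the added 1
   makes the denominator positive. *)
pose h := Num.min (e / 2) (r / (2 * (`|X| + 1))).
have X1 : 0 < `|X| + 1 by rewrite ltr_wpDl.
have h0 : 0 < h by rewrite lt_min !divr_gt0 // mulr_gt0.
have he : h < e by apply: le_lt_trans (_ : e / 2 < e); [rewrite ge_min lexx|lra].
have hr : h * `|X| < r.
  have : h <= r / (2 * (`|X| + 1)) by rewrite ge_min lexx orbT.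
  rewrite ler_pdivlMr ?mulr_gt0 // => hh.
  have := mulr_ge0 (ltW h0) (normr_ge0 X); move: hh; rewrite mulrCA mulrDr mulr1.
  move: (h * `|X|) h0 r0 => z; lra.
have seg t : 0 <= t <= 1 -> chart_cod (atlas i) (t *: (h *: X) + x) /\
    Q (t *: (h *: X) + x) <= 4 * n ^+ 2.
  move=> /andP[t0 t1]; apply: rP.
  rewrite opprD addrCA subrr addr0 normrN !normrZ (ger0_norm t0) (gtr0_norm h0).
  by apply: le_lt_trans hr; rewrite ler_piMl // mulr_ge0 // ltW.
have B0 : 0 <= 2 * h * n by rewrite !mulr_ge0 // ltW.
have [|l pq lB] := @segment_joined _ _ g i x (h *: X) _ B0.
  move=> t /seg[c1 c2]; split=> //.
  have -> : ((h *: X) *m g i (t *: (h *: X) + x) *m (h *: X)^T) 0 0 =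
      h ^+ 2 * Q (t *: (h *: X) + x).
    exact: qformZ.
  have -> : (2 * h * n) ^+ 2 = h ^+ 2 * (4 * n ^+ 2) by ring.
  by rewrite ler_wpM2l // sqr_ge0.
exists (chart_inv (atlas i) (h *: X + x)), l.
have Ux : U x = phi (f p) by rewrite /U chart_potential_map.
have Uq : U (h *: X + x) = phi (f (chart_inv (atlas i) (h *: X + x))) by [].
have := eP h; rewrite h0 he Ux Uq => /(_ isT) dec.
move: pq; rewrite chart_mapK // => pq; split=> //.
  have := mulr_gt0 h0 (mulr_gt0 d0 (exprn_gt0 2 n0)); move: dec.
  move: (phi _) (phi _) => a b; rewrite mulrA; lra.
apply: (le_trans lB); rewrite lee_fin.
have -> : 2 * h * n = 4 / (d * n) * (h * (d * n ^+ 2 / 2)).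
  by field; rewrite !gt_eqF.
rewrite ler_wpM2l ?divr_ge0 ?mulr_ge0 ?ltW //.
by move: dec; rewrite ltrNr opprB.
Qed.

End PotentialVariation.

(** * Ekeland argument and curvature bound *)

Section Ekeland.
Variables (R : realType) (M : surface R) (g : riemannian_metric M).
Implicit Types (p q : M).

(* Ekeland's variational principle: from a minimizing sequence for the order
   [l <= 2 c (u p - u q)], completeness produces a limit at which the descent
   hypothesis contradicts minimality. *)
Lemma complete_no_descent (u : M -> R) (a c : R) : complete_metric g ->
  (forall p, 0 <= u p) -> 0 < c ->
  (forall p q l, joined g p q l -> (`|u p - u q|%:E <= l)%E) ->
  (forall p, u p <= a -> exists q l,
     [/\ joined g p q l, u q < u p & (l <= (c * (u p - u q))%:E)%E]) ->
  forall p, ~ u p <= a.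
Proof.
move=> cg u0 c0 lip step p0 up0.
pose S p q := exists2 l, joined g p q l & (l <= (2 * c * (u p - u q))%:E)%E.
have Srefl p : S p p by exists 0%E; [exact: joined_refl|rewrite subrr mulr0].
have Strans p q r : S p q -> S q r -> S p r.
  move=> [l pq lle] [l' qr lle']; exists (l + l')%E; first exact: joined_cat pq qr.
  apply: le_trans (leeD lle lle') _; rewrite -EFinD lee_fin -mulrDr.
  by rewrite subrKA.
have Sle p q : S p q -> u q <= u p.
  move=> [l pq lle]; have := le_trans (lip _ _ _ pq) lle; rewrite lee_fin => H.
  have : 0 <= 2 * c * (u p - u q) by apply: le_trans H.
  by rewrite pmulr_rge0 ?subr_ge0 // mulr_gt0.
pose I p := inf [set u q | q in S p].
have hlb p : has_lbound [set u q | q in S p] by exists 0 => _ [q _ <-].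
have Inf p q : S p q -> I p <= u q by move=> pq; apply: ge_inf => //; exists q.
(* Each choice at least halves the gap to the infimum over all admissible successors, which need not
   be attained. *)
have next p : {q | S p q & u q <= (u p + I p) / 2}.
  apply: cid2; have [Ilt|Ige] := ltP (I p) (u p).
    have lt2 : I p < (u p + I p) / 2 by lra.
    have [|_ [q pq <-] uq] := inf_lt _ lt2; first by exists (u p), p.
    by exists q => //; exact: ltW.
  by exists p => //; lra.
pose P n := iter n (fun p => s2val (next p)) p0.
have PS n : S (P n) (P n.+1) by exact: s2valP (next (P n)).
have PI n : u (P n.+1) <= (u (P n) + I (P n)) / 2 by exact: s2valP' (next (P n)).
have Pm m n : (m <= n)%N -> S (P m) (P n).
  move=> /subnK <-; elim: (n - m)%N => [|k IH]; first by rewrite add0n.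
  by rewrite addSn; exact: Strans IH (PS _).
pose V := inf [set u (P n) | n in [set: nat]].
have hV : has_inf [set u (P n) | n in [set: nat]].
  by split; [exists (u (P 0%N)), 0%N|exists 0 => _ [n _ <-]].
have VP n : V <= u (P n) by apply: ge_inf; [exact: hV.2|exists n].
have near_V (e : R) : 0 < e -> exists N, forall n, (N <= n)%N -> u (P n) < V + e.
  move=> e0; have [_ [N _ <-] HN] := inf_adherent e0 hV; exists N => n Nn.
  exact: le_lt_trans (Sle _ _ (Pm _ _ Nn)) HN.
have [p plim] : exists p : M, riemannian_distance g (P n) p @[n --> \oo] --> 0%E.
  apply: cg => e e0.
  have ec : 0 < e / (2 * c) by rewrite divr_gt0 // mulr_gt0.
  have [N HN] := near_V _ ec.
  have D m n : (N <= m)%N -> (m <= n)%N -> exists2 l, joined g (P m) (P n) l & (l < e%:E)%E.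
    move=> Nm mn; have [l pq lle] := Pm _ _ mn; exists l => //.
    apply: le_lt_trans lle _; rewrite lte_fin -ltr_pdivlMl ?mulr_gt0 //.
    by have := HN _ Nm; have := VP n; rewrite mulrC; lra.
  exists N => m n Nm Nn; apply/ereal_inf_ltP.
  have [mn|nm] := leqP m n.
    by have [l pq lle] := D _ _ Nm mn; exists l.
  have [l pq lle] := D _ _ Nn (ltnW nm); exists l => //.
  exact: joined_sym.
have close (e : R) (N : nat) : 0 < e -> exists n l,
    [/\ (N <= n)%N, joined g (P n) p l & (l < e%:E)%E].
  move=> e0.
  have e0' : (0 < e%:E)%E by rewrite lte_fin.
  have [n0 _ Hn0] := plim _ (open_nbhs_nbhs (conj (@open_ereal_lt_ereal R e%:E) e0')).
  have := Hn0 (maxn N n0) (leq_maxr _ _).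
  move=> /ereal_inf_ltP[l pq lle]; exists (maxn N n0), l; split=> //.
  exact: leq_maxl.
(* The Lipschitz bound carries the limit of the values along the sequence over to the limit
   point. *)
have upV : u p = V.
  apply/eqP; rewrite -subr_eq0 -normr_le0; apply/ler_addgt0Pr => e e0; rewrite add0r.
  have e2 : 0 < e / 2 by rewrite divr_gt0.
  have [N HN] := near_V _ e2.
  have [n [l [Nn pq lle]]] := close _ N e2.
  have := le_lt_trans (lip _ _ _ pq) lle; rewrite lte_fin distrC => H.
  rewrite -(subrKA (u (P n))) (le_trans (ler_normD _ _)) // [leRHS]splitr.
  apply: lerD; first exact: ltW.
  by rewrite ger0_norm ?subr_ge0 // ltW // ltrBlDl HN.
have [|q [l [pq qp lle]]] := step p.
  by rewrite upV; apply: le_trans (VP 0%N) up0.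
have d0 : 0 < u p - u q by rewrite subr_gt0.
(* The path goes from [P n] to a late [P m], then to [p], then to [q]. The last leg costs at most
   [c * (u p - u q)] and the middle one is chosen shorter than that; the factor 2 in [S] pays for
   both. *)
have Sq n : S (P n) q.
  have [m [l' [nm pm l'lt]]] := close _ n (mulr_gt0 c0 d0).
  have [l1 p1 l1le] := Pm _ _ nm.
  exists (l1 + (l' + l))%E; first exact: joined_cat p1 (joined_cat pm pq).
  apply: le_trans (leeD l1le (leeD (ltW l'lt) lle)) _.
  rewrite -!EFinD lee_fin.
  have : c * u p <= c * u (P m) by rewrite ler_pM2l // upV.
  by move: (u (P n)) (u (P m)) (u p) (u q) => *; lra.
(* For this [N], [u (P N) < u p + (u p - u q)] and [I (P N) <= u q], so the halving rule puts
   [u (P N.+1)] strictly below [u p], the infimum of the sequence. *)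
have [N HN] := near_V _ d0.
have := HN N (leqnn _); have := VP N.+1; have := PI N; have := Inf _ _ (Sq N).
rewrite -upV; move: (u (P N)) (u (P N.+1)) (I _) (u p) (u q) => *; lra.
Qed.

End Ekeland.

(** * Estimates for the damping function *)

Section Bounds.
Variable R : realType.
Implicit Types (s k C lambda : R).

(** Past the threshold, s >= 1 bounds the affine function by L s, and s >= 2 L / k bounds L s by k
    s^2 / 2, which is below k e^s. *)
Lemma expR_dominates_affine k C lambda : 0 < k ->
  exists2 A, 0 <= A & forall s, A <= s -> C + lambda * s <= k * expR s.
Proof.
move=> k0; pose L := `|C| + `|lambda|; have L0 : 0 <= L by rewrite addr_ge0.
exists (1 + 2 * L / k); first by rewrite addr_ge0 // divr_ge0 ?mulr_ge0 // ltW.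
move=> s As.
have s1 : 1 <= s by apply: le_trans As; rewrite lerDl divr_ge0 ?mulr_ge0 // ltW.
have s0 : 0 <= s by apply: le_trans s1.
have ks : 2 * L <= k * s.
  rewrite [k * s]mulrC -ler_pdivrMr //; apply: le_trans As; by rewrite lerDr.
have E := @expR_ge1Dxn R s 1 s0; rewrite (_ : (2`!)%:R = 2) // in E.
have C1 : C <= `|C| * s by apply: le_trans (ler_norm C) _; rewrite ler_peMr.
have L1 : lambda * s <= `|lambda| * s by rewrite ler_wpM2r // ler_norm.
have LE : C + lambda * s <= L * s by rewrite /L mulrDl lerD.
have Ls : 2 * L * s <= k * s * s by rewrite ler_wpM2r.
have kE : k * (1 + s ^+ 2 / 2) <= k * expR s by rewrite ler_pM2l.
rewrite (le_trans LE) // (le_trans _ kE) //; move: Ls; rewrite expr2; nra.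
Qed.

(** The exponent is tuned to |df|^2 = C + 2 lambda f - 2 k e^f. For large s the derivative is of
    order e^(-s/2), which balances |df|; for very negative s it is of order e^(s/2), which beats the
    at most linear growth of |df|^2. The scale [L] brings the Lipschitz constant down to one. *)
Definition damped (L s : R) : R := L^-1 * (1 + expR (2^-1 * s))^-1.

Definition damped' (L s : R) : R :=
  - (L^-1 * (2^-1 * expR (2^-1 * s) / (1 + expR (2^-1 * s)) ^+ 2)).

Lemma is_derive_half_exp s :
  is_derive s 1 (fun s => expR (2^-1 * s)) (expR (2^-1 * s) * 2^-1).
Proof.
have dh : is_derive s (1 : R) (fun s : R => 2^-1 * s) 2^-1.
  apply: is_derive_eq (is_deriveZ 2^-1 (is_derive_id s (1 : R))) _.
  by rewrite -[LHS]/(_ * _) mulr1.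
exact: (is_derive_scalar_comp dh (is_derive_expR _)).
Qed.

Lemma damped_den_neq0 s : 1 + expR (2^-1 * s) != 0 :> R.
Proof. by rewrite gt_eqF // addr_gt0 // expR_gt0. Qed.

Lemma is_derive_inv (u : R -> R) s (a : R) : u s != 0 -> is_derive s 1 u a ->
  is_derive s 1 (fun t => (u t)^-1) (- (u s) ^- 2 * a).
Proof.
move=> us [d1 d2]; have dV := derivableV us d1; have dVE := deriveV us d1.
by rewrite d2 in dVE; exact: (DeriveDef dV dVE).
Qed.

Lemma is_derive_damped L s : is_derive s 1 (damped L) (damped' L s).
Proof.
have d : is_derive s (1 : R) (fun s => 1 + expR (2^-1 * s)) (0 + expR (2^-1 * s) * 2^-1).
  exact: is_deriveD (is_derive_cst _ _ _) (is_derive_half_exp s).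
have dV := @is_derive_inv (fun s => 1 + expR (2^-1 * s)) s _ (damped_den_neq0 s) d.
have E : L^-1 *: (- (1 + expR (2^-1 * s)) ^- 2 * (0 + expR (2^-1 * s) * 2^-1)) = damped' L s.
  rewrite -[LHS]/(_ * _) /damped'; have := damped_den_neq0 s.
  by move: (expR _) (L^-1) => e l e0; field.
exact: is_derive_eq (is_deriveZ L^-1 dV) E.
Qed.

Lemma continuous_half_exp : continuous (fun s : R => expR (2^-1 * s)).
Proof.
move=> s; have [d _] := is_derive_half_exp s.
exact: differentiable_continuous ((derivable1_diffP _ _).1 d).
Qed.

Lemma continuous_damped' L : continuous (damped' L).
Proof.
move=> s; have cE : {for s, continuous (fun s : R => expR (2^-1 * s))} := @continuous_half_exp s.
have c c := @cst_continuous R R c s.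
have cd := continuousD (c 1) cE.
have cd2 := continuousM cd cd.
have n0 : (1 + expR (2^-1 * s)) * (1 + expR (2^-1 * s)) != 0 :> R.
  by rewrite mulf_neq0 // damped_den_neq0.
have cv : {for s, continuous (fun s : R =>
    ((1 + expR (2^-1 * s)) * (1 + expR (2^-1 * s)))^-1)} by exact: (cvgV n0 cd2).
exact: (continuousN (continuousM (c L^-1) (continuousM (continuousM (c 2^-1) cE) cv))).
Qed.

Lemma damped_ge0 L s : 0 < L -> 0 <= damped L s.
Proof. by move=> L0; rewrite mulr_ge0 // invr_ge0 ltW // addr_gt0 // expR_gt0. Qed.

Lemma damped_mono L s A : 0 < L -> damped L s <= damped L A -> A <= s.
Proof.
move=> L0; rewrite /damped ler_pM2l ?invr_gt0 //.
rewrite lef_pV2 ?posrE ?addr_gt0 ?expR_gt0 // lerD2l ler_expR.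
by rewrite ler_pM2l // invr_gt0.
Qed.

(** With E = e^(s/2), the squared derivative is E^2 / (4 L^2 (1 + E)^4), so it suffices that E^2 N
    <= L0 (1 + E)^4. The constant, linear and exponential terms of N contribute the coefficients 1,
    4 and 2 of [L0]; taking L = 1 + L0 keeps it positive and gives L0 <= 4 L^2. *)
Lemma damped'_upper (k C lambda N s : R) :
  N = C + 2 * lambda * s - 2 * k * expR s ->
  damped' (1 + (`|C| + 4 * `|lambda| + 2 * `|k|)) s ^+ 2 * N <= 1.
Proof.
pose L0 := `|C| + 4 * `|lambda| + 2 * `|k|; rewrite -/L0.
have L00 : 0 <= L0 by rewrite /L0 !addr_ge0 // mulr_ge0.
move=> NE; rewrite /damped' sqrrN.
pose E := expR (2^-1 * s); rewrite -/E; have E0 : 0 < E by exact: expR_gt0.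
have EE : expR s = E ^+ 2.
  by rewrite -expRM_natl mulrA divff ?mul1r // pnatr_eq0.
(* The inequality e^x >= 1 + x at x = s/2 and at x = -s/2 handles the two signs of [s]. *)
have sE : `|s| * E <= 2 * (E ^+ 2 + 1).
  have h1 := expR_ge1Dx (2^-1 * s); have h2 := expR_ge1Dx (- (2^-1 * s)).
  have EV : expR (- (2^-1 * s)) * E = 1 by rewrite mulrC /E expRxMexpNx_1.
  have a1 : s <= 2 * E by rewrite -/E in h1; lra.
  have a2 : - s * E <= 2.
    have : - s <= 2 * expR (- (2^-1 * s)) by lra.
    by move=> /(ler_wpM2r (ltW E0)); rewrite -mulrA EV mulr1.
  have a3 : s * E <= 2 * E ^+ 2 by rewrite expr2 mulrA ler_wpM2r // ltW.
  have E2 : 0 <= E ^+ 2 by rewrite sqr_ge0.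
  by case: (ger0P s) => _; lra.
have bound : E ^+ 2 * N <= L0 * (1 + E) ^+ 4.
  have N1 : N <= `|C| + 2 * (`|lambda| * `|s|) + 2 * `|k| * E ^+ 2.
    rewrite NE EE; have := ler_norm C; have := ler_norm (lambda * s).
    have : - k * E ^+ 2 <= `|k| * E ^+ 2 by rewrite ler_wpM2r ?sqr_ge0 // -normrN ler_norm.
    rewrite normrM; move: (E ^+ 2) (`|lambda| * `|s|) => *; lra.
  have N2 := ler_wpM2l (sqr_ge0 E) N1.
  apply: (le_trans N2).
  have ls : `|lambda| * (`|s| * E) * E <= `|lambda| * (2 * (E ^+ 2 + 1)) * E.
    by apply: ler_wpM2r; [exact: ltW|rewrite ler_wpM2l].
  have b1 : `|C| * E ^+ 2 <= `|C| * (1 + E) ^+ 4.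
    rewrite ler_wpM2l // -subr_ge0.
    rewrite (_ : _ - _ = 1 + 4 * E + 5 * E ^+ 2 + 4 * E ^+ 3 + E ^+ 4); last by ring.
    by rewrite !addr_ge0 // ?mulr_ge0 // ?exprn_ge0 // ltW.
  have b2 : `|lambda| * ((E ^+ 2 + 1) * E) <= `|lambda| * (1 + E) ^+ 4.
    rewrite ler_wpM2l // -subr_ge0.
    rewrite (_ : _ - _ = 1 + 3 * E + 6 * E ^+ 2 + 3 * E ^+ 3 + E ^+ 4); last by ring.
    by rewrite !addr_ge0 // ?mulr_ge0 // ?exprn_ge0 // ltW.
  have b3 : `|k| * E ^+ 4 <= `|k| * (1 + E) ^+ 4.
    rewrite ler_wpM2l // -subr_ge0.
    rewrite (_ : _ - _ = 1 + 4 * E + 6 * E ^+ 2 + 4 * E ^+ 3); last by ring.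
    by rewrite !addr_ge0 // ?mulr_ge0 // ?exprn_ge0 // ltW.
  rewrite (_ : E ^+ 2 * _ = `|C| * E ^+ 2 + 2 * (`|lambda| * (`|s| * E) * E) + 2 * (`|k| * E ^+ 4));
    last by ring.
  rewrite (_ : `|lambda| * (2 * (E ^+ 2 + 1)) * E = 2 * (`|lambda| * ((E ^+ 2 + 1) * E))) in ls;
    last by ring.
  rewrite /L0; move: ls b1 b2 b3.
  move: (`|lambda| * (`|s| * E) * E) (`|C| * E ^+ 2) (`|lambda| * ((E ^+ 2 + 1) * E)) (`|k| * E ^+ 4).
  move: ((1 + E) ^+ 4) => F x1 x2 x3 x4; lra.
have D0 : 0 < (1 + E) ^+ 4 by rewrite exprn_gt0 // addr_gt0.
have L1 : 0 < 1 + L0 by rewrite ltr_wpDr.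
rewrite (_ : _ * N = (E ^+ 2 * N) / (4 * (1 + L0) ^+ 2 * (1 + E) ^+ 4)); last first.
  by field; rewrite !gt_eqF // addr_gt0.
rewrite ler_pdivrMr ?mul1r; last by rewrite mulr_gt0 // mulr_gt0 // exprn_gt0.
apply: (le_trans bound); rewrite ler_wpM2r ?(ltW D0) //.
by nra.
Qed.

(** With E = e^(s/2) >= 1, (1 + E)^2 <= 4 E^2 gives d >= 1 / (8 L E). The last premise spends half
    of -2 k E^2 on the affine part of N, leaving N >= -k E^2. In the product the factors E
    cancel. *)
Lemma damped'_lower (L k C lambda N s : R) : 0 < L -> k < 0 -> 0 <= s ->
  N = C + 2 * lambda * s - 2 * k * expR s -> - C - 2 * lambda * s <= - k * expR s ->
  let d := L^-1 * (2^-1 * expR (2^-1 * s) / (1 + expR (2^-1 * s)) ^+ 2) in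
  [/\ 0 < d, 0 < N & Num.sqrt (- k) / (8 * L) <= d * Num.sqrt N].
Proof.
move=> L0 k0 s0 NE h d.
pose E := expR (2^-1 * s).
have E1 : 1 <= E by rewrite /E -expR0 ler_expR mulr_ge0.
have E0 : 0 < E by exact: expR_gt0.
have EE : expR s = E ^+ 2.
  by rewrite -expRM_natl mulrA divff ?mul1r // pnatr_eq0.
have NG : - k * E ^+ 2 <= N by rewrite NE; move: h; rewrite EE; move: (E ^+ 2) => *; lra.
have kE0 : 0 < - k * E ^+ 2 by rewrite mulr_gt0 ?oppr_gt0 // exprn_gt0.
have d_ge : (8 * L * E)^-1 <= d.
  rewrite /d -/E (_ : L^-1 * _ = (L * 2 * ((1 + E) ^+ 2 / E))^-1); last first.
    by field; rewrite !gt_eqF // addr_gt0.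
  rewrite lef_pV2 ?posrE ?mulr_gt0 ?invr_gt0 ?exprn_gt0 ?addr_gt0 //.
  rewrite (_ : 8 * L * E = L * 2 * (4 * E)); last by ring.
  rewrite ler_pM2l ?mulr_gt0 // ler_pdivrMr // -subr_ge0.
  rewrite (_ : _ - _ = (E - 1) * (3 * E + 1)); last by ring.
  by rewrite mulr_ge0 ?subr_ge0 // addr_ge0 // mulr_ge0 // ltW.
split.
- by rewrite /d -/E !mulr_gt0 // ?invr_gt0 // exprn_gt0 // addr_gt0.
- exact: lt_le_trans NG.
have sq : Num.sqrt (- k) * E <= Num.sqrt N.
  have -> : Num.sqrt (- k) * E = Num.sqrt (- k * E ^+ 2).
    by rewrite sqrtrM ?sqrtr_sqr ?gtr0_norm // oppr_ge0 ltW.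
  exact: ler_wsqrtr.
rewrite (_ : _ / _ = (8 * L * E)^-1 * (Num.sqrt (- k) * E)); last first.
  by field; rewrite !gt_eqF.
by apply: ler_pM => //; rewrite ?invr_ge0 ?mulr_ge0 ?sqrtr_ge0 // ltW.
Qed.

End Bounds.

Theorem corollary1 (R : realType) (M : surface R) (g : riemannian_metric M)
    (f : M -> R) :
  gradient_ricci_soliton g f ->
  connected [set: M] ->
  complete_metric g ->
  exists B : R, forall p : M, `|gauss_curvature g p| <= B.
Proof.
move=> [smooth_f [lambda soliton]] cM cg.
have [k [C H]] := global_first_integrals smooth_f soliton cM.
have KE p : gauss_curvature g p = k * expR (f p).
  by have [<- _] := H _ p (index_atP p).
have NE i p : chart_dom (atlas i) p ->
    chart_gradient_norm2 g f i p = C + 2 * lambda * f p - 2 * k * expR (f p).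
  by move=> ip; have [_ <-] := H i p ip; rewrite subrK addrK.
suff [A fA] : exists A, forall p, k = 0 \/ f p <= A.
  exists (`|k| * expR A) => p; rewrite KE normrM (gtr0_norm (expR_gt0 _)).
  have [->|fp] := fA p; first by rewrite normr0 !mul0r.
  by rewrite ler_wpM2l // ler_expR.
have [k0|k0|->] := ltgtP k 0; last by exists 0 => p; left.
- have mk0 : 0 < - k by rewrite oppr_gt0.
  (* Beyond [A] half of the term -2 k e^f absorbs the affine part of |df|^2, so |df|^2 >= -k e^f
     there. *)
  have [A A0 HA] := expR_dominates_affine (- C) (- (2 * lambda)) mk0.
  exists A => p0; right.
  pose L := 1 + (`|C| + 4 * `|lambda| + 2 * `|k|).
  have L0 : 0 < L by rewrite ltr_wpDr // !addr_ge0 // mulr_ge0.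
  have lip i p : chart_dom (atlas i) p ->
      damped' L (f p) ^+ 2 * chart_gradient_norm2 g f i p <= 1.
    by move=> ip; exact: damped'_upper (NE i p ip).
  (* The cost factor of [gradient_step], with its denominator replaced by the uniform lower bound of
     [damped'_lower]. *)
  pose c := 4 / (Num.sqrt (- k) / (8 * L)).
  have sk : 0 < Num.sqrt (- k) by rewrite sqrtr_gt0.
  have c0 : 0 < c by rewrite !divr_gt0 // mulr_gt0.
  rewrite leNgt; apply/negP => Ap0.
  (* [damped L] is decreasing, so the sublevel set on which descent is required is the region f >=
     A, and it contains [p0]. *)
  apply: (@complete_no_descent _ _ g (fun p => damped L (f p)) (damped L A) c cg _ c0 _ _ p0).
  + by move=> p; exact: damped_ge0.
  + move=> p q l pq.
    exact: (joined_variation smooth_f (is_derive_damped L) (@continuous_damped' _ L) pq lip).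
  + move=> p /(damped_mono L0) Ap.
    have ip := index_atP p; set i := index_at p in ip.
    have h : - C - 2 * lambda * f p <= - k * expR (f p).
      by rewrite -mulNr; exact: HA.
    have [d0 N0 dN] := damped'_lower L0 k0 (le_trans A0 Ap) (NE i p ip) h.
    have [q [l [pq uq lle]]] := gradient_step smooth_f (is_derive_damped L) ip d0 erefl N0.
    exists q, l; split=> //; apply: (le_trans lle); rewrite lee_fin.
    apply: ler_wpM2r; first by rewrite subr_ge0 ltW.
    rewrite /c ler_pM2l // lef_pV2 // posrE.
      by rewrite mulr_gt0 // sqrtr_gt0.
    by rewrite divr_gt0 // mulr_gt0.
  + rewrite /damped ler_pM2l ?invr_gt0 // lef_pV2 ?posrE ?addr_gt0 ?expR_gt0 //.
    by rewrite lerD2l ler_expR ler_pM2l ?invr_gt0 // ltW.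
- have k2 : 0 < 2 * k by rewrite mulr_gt0.
  (* The extra 1 makes the inequality strict: beyond [A], |df|^2 would be at most -1. *)
  have [A A0 HA] := expR_dominates_affine (C + 1) (2 * lambda) k2.
  exists A => p; right; rewrite leNgt; apply/negP => Ap.
  have ip := index_atP p.
  have := chart_gradient_norm2_ge0 g f ip; rewrite NE //.
  by have := HA _ (ltW Ap); move: (2 * lambda * f p) (2 * k * expR (f p)) => *; lra.
Qed.
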